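(* Let $G=PSL(2,7)$ and let $\mathcal{L}G=\{H \mid 1<H<G\}$ be the poset of all nontrivial proper subgroups of $G$, ordered by inclusion. Then the order complex $\Delta\mathcal{L}G$ is homotopy equivalent to a wedge of $48$ circles and $48$ two-dimensional spheres: $$\Delta\mathcal{L}\,PSL(2,7)\;\simeq\;\bigvee^{48}S^1\;\vee\;\bigvee^{48}S^2 .$$
   Context: For a finite poset $P$, $\Delta P$ denotes its order complex: the simplicial complex (identified with its geometric realization) with vertex set $P$ whose simplices are the nonempty finite chains $x_0<x_1<\dots<x_k$ of $P$. $PSL(2,7)$ is the projective special linear group of $2\times 2$ matrices over the field with $7$ elements. *)

(* Defs.v *)
From HB Require Import structures.
From mathcomp Require Import all_boot all_order all_algebra.
From mathcomp Require Import all_fingroup all_solvable.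
From mathcomp Require Import boolp classical_sets functions reals topology.
From mathcomp Require Import normedtype wedge_sigT.

Set Implicit Arguments.
Unset Strict Implicit.
Unset Printing Implicit Defensive.

Import Order.TTheory GRing.Theory Num.Theory.
Import numFieldTopology.Exports numFieldNormedType.Exports.

Local Open Scope classical_set_scope.
Local Open Scope ring_scope.

(* The library's {'GL_n[F]} consists of matrices of size n.-1.+1, so this is the
   usual group only for n >= 1. *)
Definition SL (n : nat) (F : finFieldType) : {set {'GL_n[F]}} :=
  [set u | \det (GLval u) == 1]%SET.

Lemma SL_group_set (n : nat) (F : finFieldType) : group_set (SL n F).
Proof.
apply/group_setP; split=> [|u v]; first by rewrite inE GL_1E det1.
by rewrite !inE GL_ME det_mulmx => /eqP-> /eqP->; rewrite mulr1.
Qed.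

Canonical SL_group (n : nat) (F : finFieldType) : {group {'GL_n[F]}} :=
  Group (SL_group_set n F).

Definition PSL (n : nat) (F : finFieldType) :
    {group coset_of 'Z(SL_group n F)%g} :=
  (SL_group n F / 'Z(SL_group n F))%G.

Definition proper_nontrivial (gT : finGroupType) (G H : {group gT}) : bool :=
  ([1 gT]%G \proper H) && (H \proper G).

Definition subgroup_poset (gT : finGroupType) (G : {group gT}) : Type :=
  {H : {group gT} | proper_nontrivial G H}.

Fact subgroup_display : Order.disp_t. Proof. exact: Order.Disp tt tt. Qed.

Section SubgroupPoset.
Context (gT : finGroupType) (G : {group gT}).
Implicit Types H K L : subgroup_poset G.

HB.instance Definition _ := SubFinite.on (subgroup_poset G).

Definition subgroup_le H K : bool := val H \subset val K.

Fact subgroup_le_refl : reflexive subgroup_le.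
Proof. by move=> H; exact: subxx. Qed.

Fact subgroup_le_anti : antisymmetric subgroup_le.
Proof.
by move=> H K HK; apply/val_inj/val_inj/eqP; rewrite finset.eqEsubset.
Qed.

Fact subgroup_le_trans : transitive subgroup_le.
Proof. by move=> K H L; exact: fintype.subset_trans. Qed.

HB.instance Definition _ := Order.Le_isPOrder.Build subgroup_display
  (subgroup_poset G) subgroup_le_refl subgroup_le_anti subgroup_le_trans.

End SubgroupPoset.

Definition order_complex (d : Order.disp_t) (P : finPOrderType d) :
    {set {set P}} :=
  [set s | (s != finset.set0) &&
           [forall x in s, forall y in s, (x >=< y)%O]]%SET.

(* The points of the realization are their barycentric coordinates.  Since V is
   finite, the topology of pointwise convergence is the Euclidean one, and the
   subset topology is the weak topology of the complex. *)
Definition realization_set (R : realType) (V : finType) (K : {set {set V}}) :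
    set {ptws V -> R} :=
  [set t | [/\ forall v, 0 <= t v, \sum_(v : V) t v = 1
             & [set v | t v != 0]%SET \in K]].
Arguments realization_set R {V} K.

Definition realization (R : realType) (V : finType) (K : {set {set V}}) :
    topologicalType :=
  set_type (realization_set R K).
Arguments realization R {V} K.

Section Homotopy.
Context (R : realType).

Definition unit_interval : set R := `[0, 1]%classic.

Fact unit_interval_mem0 : (0 : R) \in unit_interval.
Proof. by apply: mem_set; rewrite /unit_interval /= in_itv /= lexx ler01. Qed.

Fact unit_interval_mem1 : (1 : R) \in unit_interval.
Proof. by apply: mem_set; rewrite /unit_interval /= in_itv /= lexx ler01. Qed.

Definition ui0 : unit_interval := exist _ 0 unit_interval_mem0.
Definition ui1 : unit_interval := exist _ 1 unit_interval_mem1.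

Definition homotopic (X Y : topologicalType) (f g : X -> Y) : Prop :=
  exists h : X * unit_interval -> Y,
    [/\ continuous h, forall x, h (x, ui0) = f x
      & forall x, h (x, ui1) = g x].

Definition homotopy_equivalent (X Y : topologicalType) : Prop :=
  exists (f : X -> Y) (g : Y -> X),
    [/\ continuous f, continuous g,
        homotopic (g \o f) id & homotopic (f \o g) id].

(* The norm of 'rV[R]_n in the library is the sup norm, so the Euclidean unit
   sphere is written with a sum of squares; S^n lies in R^(n+1). *)
Definition sphere (n : nat) : set 'rV[R]_n.+1 :=
  [set v | \sum_(i < n.+1) v 0 i ^+ 2 = 1].
Arguments sphere : clear implicits.

Fact sphere_pole_mem (n : nat) : (delta_mx 0 0 : 'rV[R]_n.+1) \in sphere n.
Proof.
apply: mem_set; rewrite /sphere /= (bigD1 (0 : 'I_n.+1)) //=.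
rewrite mxE !eqxx expr1n big1 ?addr0 //.
by move=> i /negPf i0; rewrite mxE i0 andbF expr0n.
Qed.

Definition sphere_pole (n : nat) : sphere n :=
  exist _ (delta_mx 0 0) (sphere_pole_mem n).

Definition sphere_wedge (I : choiceType) (dim : I -> nat) : topologicalType :=
  wedge (fun i : I => sphere_pole (dim i)).

End Homotopy.

Arguments sphere : clear implicits.
Arguments sphere_pole : clear implicits.
Arguments sphere_wedge R {I} dim.

(* Main.v *)
Require Import Defs.
From mathcomp Require Import boolp classical_sets functions cardinality topology.
From mathcomp Require Import normedtype wedge_sigT.
From mathcomp Require Import all_boot all_order all_algebra all_fingroup all_solvable.
From mathcomp Require Import mathcomp_extra reals ring lra.

Set Implicit Arguments.
Unset Strict Implicit.
Unset Printing Implicit Defensive.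
Import Order.TTheory GRing.Theory Num.Theory.
Import numFieldTopology.Exports numFieldNormedType.Exports.

(** Let K be the order complex of the poset of the 177 proper nontrivial
    subgroups of G = PSL(2,7).  The proof removes 48 facets of dimension 1 and 48
    facets of dimension 2 from K in such a way that the complex A that is left
    collapses to a vertex.  As A contains the boundary of each removed facet and
    is contractible, K is homotopy equivalent to K/A, and K/A is the wedge of the
    spheres that are obtained by pinching the boundary of each removed facet.

    The removed edges: each of the eight subgroups F of order 21 lies only above
    its subgroups of order 7 and 3, so the seven edges from a C3 up to F are
    facets.  Six of the seven are removed for each F.

    The removed triangles: G acts on the Fano plane as GL(3,2).  The 14 subgroups
    S4 are the stabilizers of points and lines, the 21 subgroups D8 those of
    flags, the 28 subgroups S3 those of antiflags; the 14 Klein four-groups are the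
    pointwise stabilizers of lines and their duals, and the 21 involutions are the
    transvections.  An S3 has two S4 above it and three C2 below it, so that the
    six triangles C2 < S3 < S4 through it are facets.  Without the S3, these
    subgroups form a complex that is equivalent to the incidence graph of the
    plane, which has eight independent cycles.  In that graph the point and the
    line of an antiflag are opposite and are joined by three paths, one for each
    C2; so adding the S3 glues in two discs.  Eight of the 56 discs kill the
    cycles one after another; the 48 others give the removed triangles, two at 20
    of the S3 and one at each of the eight others.  The remaining subgroups
    (C7, then F, A4, C4 and C3) are collapsed at the start, as vertices whose link
    is a cone.

    The topological part is [realization_wedge]: if A collapses to a vertex, then
    K is equivalent to the wedge.  A collapse is a list of steps (s, v), where the
    link of the face s is a cone with apex v; the star of s is then pushed away
    towards v by an explicit flow on barycentric coordinates ([push], [flow]).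
    This contraction of A extends to a deformation of K ([deform]) that ends by
    mapping A to a point.  The map [to_wedge] from K to the wedge identifies
    exactly the points of A; as it is a surjection from a compact space to a
    Hausdorff one, it is a quotient map, so that the deformation descends to the
    inverse equivalence and to the two homotopies.

    The combinatorial part is a computation.  The 168 elements of G are
    represented by matrices modulo 7 up to sign, and the subgroups by bit masks;
    [classification] shows that the masks found are all the subgroups, because
    adding an element to a listed subgroup generates a listed subgroup or G.  The
    list of collapse steps is checked by [certificate_ok] against the
    comparability graph of the 177 masks. *)

(** * Continuity, compactness and separation *)

Section Toolkit.
Local Open Scope classical_set_scope.
Local Open Scope ring_scope.

Lemma cont_pair (X Y Z : topologicalType) (f : X -> Y) (g : X -> Z) :
  continuous f -> continuous g -> continuous (fun x => (f x, g x)).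
Proof. by move=> cf cg x; apply: cvg_pair; [exact: cf|exact: cg]. Qed.

Lemma cont_comp (X Y Z : topologicalType) (f : X -> Y) (g : Y -> Z) :
  continuous f -> continuous g -> continuous (fun x => g (f x)).
Proof. by move=> cf cg x; apply: (@continuous_comp _ _ _ f g); [exact: cf|exact: cg]. Qed.

Lemma cont_id (X : topologicalType) : continuous (fun x : X => x).
Proof. by move=> x; exact: cvg_id. Qed.

Lemma cont_const (X Y : topologicalType) (y : Y) : continuous (fun _ : X => y).
Proof. by move=> x; exact: cvg_cst. Qed.

Lemma cont_fst (X Y : topologicalType) : continuous (fun p : X * Y => p.1).
Proof. by move=> x; exact: cvg_fst. Qed.

Lemma cont_snd (X Y : topologicalType) : continuous (fun p : X * Y => p.2).
Proof. by move=> x; exact: cvg_snd. Qed.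

Lemma cont_prod (T : topologicalType) (I : eqType) (Y : I -> topologicalType)
  (F : T -> prod_topology Y) :
  (forall i, continuous (fun x => F x i)) -> continuous F.
Proof.
move=> cF x; apply/cvg_sup => i.
have surj y : exists2 g : prod_topology Y, True & g i = y.
  by exists (dfwith (F x) i y) => //; rewrite dfwithin.
apply/cvg_image; last first.
  move=> U /= nU.
  exists [set g : prod_topology Y | U (g i)]; last first.
    rewrite classical_sets.eqEsubset; split => [y [g Ug <-] //|y Uy].
    by have [g _ gy] := surj y; exists g; rewrite /= ?gy.
  exact: (cF i x U nU).
by rewrite -classical_sets.subTset => y _; have [g _ gy] := surj y; exists g.
Qed.

Section Continuity.
Context {R : realType} {T : topologicalType}.
Implicit Types f g : T -> R.

Lemma contD f g : continuous f -> continuous g -> continuous (fun x => f x + g x).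
Proof. by move=> cf cg x; apply: (@cvgD _ _ _ _ _ f g); [exact: cf|exact: cg]. Qed.

Lemma contN f : continuous f -> continuous (fun x => - f x).
Proof. by move=> cf x; apply: (@cvgN _ _ _ _ _ f); exact: cf. Qed.

Lemma contB f g : continuous f -> continuous g -> continuous (fun x => f x - g x).
Proof. by move=> cf cg; apply: contD => //; apply: contN. Qed.

Lemma contM f g : continuous f -> continuous g -> continuous (fun x => f x * g x).
Proof. by move=> cf cg x; apply: (@cvgM _ _ _ _ f g); [exact: cf|exact: cg]. Qed.

Lemma contV f : (forall x, f x != 0) -> continuous f -> continuous (fun x => (f x)^-1).
Proof. by move=> f0 cf x; apply: (@cvgV _ _ _ _ f) => //; exact: cf. Qed.

Lemma cont_min f g : continuous f -> continuous g -> continuous (fun x => Num.min (f x) (g x)).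
Proof. by move=> cf cg x; apply: (@continuous_min _ _ f g); [exact: cf|exact: cg]. Qed.

Lemma cont_max f g : continuous f -> continuous g -> continuous (fun x => Num.max (f x) (g x)).
Proof. by move=> cf cg x; apply: (@continuous_max _ _ f g); [exact: cf|exact: cg]. Qed.

Lemma cont_sum (I : Type) (r : seq I) (P : pred I) (F : I -> T -> R) :
  (forall i, continuous (F i)) -> continuous (fun x => \sum_(i <- r | P i) F i x).
Proof.
move=> cF; elim: r => [|i r IH].
  rewrite (_ : (fun _ => _) = fun=> 0); first exact: cont_const.
  by apply/funext => x; rewrite big_nil.
rewrite (_ : (fun _ => _) = fun x => (if P i then F i x else 0) + \sum_(j <- r | P j) F j x).
  by apply: contD IH; case: (P i); [exact: cF|exact: cont_const].
by apply/funext => x; rewrite big_cons; case: (P i); rewrite ?add0r.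
Qed.

Lemma cont_bigmin (I : Type) (r : seq I) (P : pred I) (d : T -> R) (F : I -> T -> R) :
  continuous d -> (forall i, continuous (F i)) ->
  continuous (fun x => \big[Num.min/d x]_(i <- r | P i) F i x).
Proof.
move=> cd cF; elim: r => [|i r IH].
  by rewrite (_ : (fun _ => _) = d) //; apply/funext => x; rewrite big_nil.
have [Pi|/negPf Pi] := boolP (P i); last first.
  by under eq_fun do rewrite big_cons Pi.
by under eq_fun do rewrite big_cons Pi; apply: cont_min.
Qed.

Lemma cont_ptws (V : eqType) (F : T -> {ptws V -> R}) :
  (forall v, continuous (fun x => F x v)) -> continuous F.
Proof. exact: (@cont_prod T V (fun=> R)). Qed.

Lemma cont_eval (V : eqType) (v : V) : continuous (fun t : {ptws V -> R} => t v).
Proof. exact: (@proj_continuous V (fun=> R) v). Qed.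

Lemma cont_set_type (Y : topologicalType) (A : set Y) (F : T -> A) :
  continuous (fun x => val (F x)) -> continuous F.
Proof. exact: (@continuous_comp_initial A T Y (@set_val _ A) F). Qed.

Lemma cont_val (Y : topologicalType) (A : set Y) : continuous (fun x : A => val x).
Proof. exact: (@initial_continuous A Y (@set_val _ A)). Qed.

Lemma cont_rV n (F : T -> 'rV[R]_n) : (forall i, continuous (fun x => F x 0 i)) -> continuous F.
Proof.
move=> cF x A [P nP sPA].
have nB j : nbhs x [set y | P 0 j (F y 0 j)] by apply: (cF j x); exact: nP.
apply: (filterS _ (@filter_forall _ _ _ _ _ nB)) => y By; apply: sPA => i j.
by rewrite ord1; exact: By.
Qed.
End Continuity.

Lemma compact_set_type (Y : topologicalType) (A : set Y) : compact A -> compact [set: A].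
Proof.
move=> cA F PF _.
have [|p [Ap pcl]] := cA (val @ F) _.
  by apply: (@filterS _ F _ classical_sets.setT) => [x _|]; [exact: set_valP|exact: filterT].
exists (exist _ p (mem_set Ap)); split=> // U W FU [_ [[O oO <-] /= Op OW]].
have [||q [[x Ux <-] Oq]] := pcl (val @` U) O.
- by apply: (@filterS _ F _ U) => // x Ux; exists x.
- exact: open_nbhs_nbhs.
by exists x; split=> //; exact: OW.
Qed.

Lemma hausdorff_set_type (Y : topologicalType) (A : set Y) : hausdorff_space Y -> hausdorff_space A.
Proof.
move=> hY x y cxy; apply/val_inj/hY => U W nU nW.
have [z [Uz Wz]] := cxy (val @^-1` U) (val @^-1` W)
  (@cont_val Y A x U nU) (@cont_val Y A y W nW).
by exists (val z).
Qed.

Lemma hausdorff_prod (X Y : topologicalType) : hausdorff_space X -> hausdorff_space Y ->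
   hausdorff_space (X * Y)%type.
Proof.
move=> hX hY [x1 y1] [x2 y2] cl; congr pair.
  apply: hX => U W nU nW.
  have [||[a b] [Ua Wa]] := cl (fst @^-1` U) (fst @^-1` W); last by exists a.
    exact: (@cvg_fst _ _ (nbhs x1) (nbhs y1)).
  exact: (@cvg_fst _ _ (nbhs x2) (nbhs y2)).
apply: hY => U W nU nW.
have [||[a b] [Ua Wa]] := cl (snd @^-1` U) (snd @^-1` W); last by exists b.
  exact: (@cvg_snd _ _ (nbhs x1) (nbhs y1)).
exact: (@cvg_snd _ _ (nbhs x2) (nbhs y2)).
Qed.

(** Such a map is closed, hence a quotient map: this is what lets functions on
    the wedge, and on its product with the interval, be defined by choosing
    preimages in the complex. *)
Lemma compact_surj_quotient (X Y Z : topologicalType) (q : X -> Y) (k : Y -> Z) :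
  compact [set: X] -> hausdorff_space Y -> continuous q -> (forall y, exists x, q x = y) ->
  continuous (k \o q) -> continuous k.
Proof.
move=> cX hY cq sq /continuous_closedP ckq; apply/continuous_closedP => A cA.
have -> : k @^-1` A = q @` ((k \o q) @^-1` A).
  rewrite classical_sets.eqEsubset; split=> [y /= Ay|_ [x /= Ax <-]//].
  by have [x xy] := sq y; exists x; rewrite /= ?xy.
apply: compact_closed => //; apply: continuous_compact.
  exact: continuous_subspaceT.
exact: subclosed_compact (ckq _ cA) cX _.
Qed.

End Toolkit.

(** * Collapses of a simplicial complex as flows on barycentric coordinates *)

Section Collapse.
Local Open Scope classical_set_scope.
Local Open Scope ring_scope.
Context {R : realType} {V : finType}.
Implicit Types (N : {set {set V}}) (s c : {set V}) (t : V -> R) (u v w : V).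

(** A complex is given by a set [N] of nonfaces.  A nonnegative [t] has its
    support in the complex when it vanishes somewhere on each nonface; the total
    weight of [t] is left free because [flow] is later applied to points whose
    weight is less than 1. *)
Definition cone N t : Prop :=
  (forall v, 0 <= t v) /\ forall c, c \in N -> exists2 u, u \in c & t u = 0.

(** The default value of the minimum is the total weight, which is never smaller
    than a coordinate of a nonnegative [t]. *)
Definition min_coord s t : R := \big[Num.min/(\sum_v t v)]_(u in s) t u.

Lemma min_coord_ge0 s t : (forall v, 0 <= t v) -> 0 <= min_coord s t.
Proof.
by move=> t0; apply: le_bigmin => [|u _]; [apply: sumr_ge0 => v _|]; exact: t0.
Qed.

Lemma min_coord_le s t u : u \in s -> min_coord s t <= t u.
Proof. by move=> us; apply: bigmin_le_cond. Qed.

Lemma min_coord_attained s t : (forall v, 0 <= t v) -> s != finset.set0 ->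
  exists2 u, u \in s & min_coord s t = t u.
Proof.
move=> t0 /set0Pn[w ws]; rewrite /min_coord.
have [|u us ->] := @eq_bigmin _ R V (\sum_v t v) w (mem s) t ws; last by exists u.
by move=> i _; rewrite (bigD1 i) //= lerDl sumr_ge0.
Qed.

Lemma min_coord0 s t u : (forall v, 0 <= t v) -> u \in s -> t u = 0 -> min_coord s t = 0.
Proof.
move=> t0 us tu; apply/eqP; rewrite eq_le min_coord_ge0 // andbT -tu.
exact: min_coord_le.
Qed.

Lemma min_coord_continuous (T : topologicalType) s (F : T -> V -> R) :
  (forall v, continuous (F^~ v)) -> continuous (fun x => min_coord s (F x)).
Proof.
move=> cF; apply: (@cont_bigmin R T V _ _ (fun x => \sum_v F x v) (fun u x => F x u)) => //.
exact: (@cont_sum R T V _ _ (fun u x => F x u)).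
Qed.

(** The elementary collapse at time [r]: the weight that all vertices of [s] have
    in common is moved from [s] to [v].  Nothing moves when the support of [t]
    does not contain [s], so that no case distinction is needed for continuity. *)
Definition push s v (r : R) t : V -> R := fun w =>
  t w - r * min_coord s t * (w \in s)%:R + r * min_coord s t * (#|s|%:R * (w == v)%:R).

Lemma sum_indicator s : \sum_v (v \in s)%:R = #|s|%:R :> R.
Proof.
rewrite -natr_sum -sum1_card [in RHS]big_mkcond /=; congr _%:R.
Qed.

Lemma sum_point v : \sum_w (w == v)%:R = 1 :> R.
Proof. by rewrite (bigD1 v) //= eqxx big1 ?addr0 // => w /negPf->. Qed.

Lemma sum_push s v r t : \sum_w push s v r t w = \sum_w t w.
Proof.
rewrite /push !big_split /= sumrN -!mulr_sumr sum_indicator sum_point mulr1.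
by rewrite addrNK.
Qed.

Lemma push0 s v t : push s v 0 t = t.
Proof. by apply/funext => w; rewrite /push !mul0r subr0 addr0. Qed.

Lemma push_ge0 s v r t : 0 <= r <= 1 -> (forall w, 0 <= t w) -> forall w, 0 <= push s v r t w.
Proof.
move=> /andP[r0 r1] t0 w; apply: addr_ge0; last first.
  by rewrite !mulr_ge0 ?min_coord_ge0.
have m0 := min_coord_ge0 s t0.
rewrite subr_ge0; case: (boolP (w \in s)) => [ws|_]; last by rewrite mulr0.
rewrite mulr1 (le_trans _ (min_coord_le t ws)) //.
exact: ler_piMl.
Qed.

(** In terms of nonfaces: whenever [x] is a face that contains [s], the set
    [v |: x] is a face too. *)
Definition link_coned N s v :=
  forall c, c \in N -> v \in c -> exists2 c', c' \in N & c' \subset (c :\ v) :|: s.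

(** A nonface [c] that avoids [v] still has a vanishing coordinate, as [push] only
    adds weight at [v].  A nonface through [v] has one away from [v], on account
    of the nonface contained in [(c :\ v) :|: s]. *)
Lemma push_cone N s v r t : link_coned N s v ->
  0 <= r <= 1 -> cone N t -> cone N (push s v r t).
Proof.
move=> Nsv r01 [t0 tN]; split; first exact: push_ge0.
have m0 := min_coord_ge0 s t0.
move=> c cN.
have [m_eq0|m_neq0] := eqVneq (min_coord s t) 0.
  have [u uc tu] := tN c cN; exists u => //.
  by rewrite /push m_eq0 tu !(mulr0, mul0r) subr0 addr0.
have spos u : t u = 0 -> u \notin s.
  by move=> tu; apply: contra_neqN m_neq0 => us; exact: min_coord0 us tu.
suff [u uc [uv tu]] : exists2 u, u \in c & u != v /\ t u = 0.
  exists u => //.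
  by rewrite /push tu (negPf (spos _ tu)) (negPf uv) !mulr0 subr0 addr0.
have [vc|vc] := boolP (v \in c); last first.
  have [u uc tu] := tN c cN; exists u => //; split=> //.
  by apply: contraNneq vc => <-.
have [c' c'N /fintype.subsetP c's] := Nsv c cN vc.
have [u uc' tu] := tN c' c'N.
move: (c's _ uc'); rewrite !inE (negPf (spos _ tu)) orbF => /andP[uv uc].
by exists u.
Qed.

(** At time 1 the smallest coordinate on [s] has become 0, so [s] is no longer
    contained in the support. *)
Lemma push1_cone N s v t : s != finset.set0 -> v \notin s -> link_coned N s v ->
  cone N t -> cone (s |: N) (push s v 1 t).
Proof.
move=> s0 vs Nsv tN.
have r01 : 0 <= (1 : R) <= 1 by rewrite ler01 lexx.
have [p0 pN] := push_cone Nsv r01 tN; split=> // c.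
case/setU1P => [->{c}|]; last exact: pN.
have [u us mu] := min_coord_attained (proj1 tN) s0; exists u => //.
rewrite /push us mu (_ : u == v = false).
  by rewrite mul1r !(mulr0, mulr1) subrr addr0.
by apply: contraNF vs => /eqP<-.
Qed.

(** Each step removes the star of a face [s], which amounts to adding [s] to the
    nonfaces. *)
Fixpoint collapses N (st : seq ({set V} * V)) : Prop :=
  if st is (s, v) :: st' then
    [/\ s != finset.set0, v \notin s, link_coned N s v & collapses (s |: N) st']
  else True.

Definition clamp (r : R) := Num.max 0 (Num.min r 1).

Lemma clamp_itv r : 0 <= clamp r <= 1.
Proof. by rewrite /clamp le_max lexx /= ge_max ler01 ge_min lexx orbT. Qed.

Lemma clamp_le0 r : r <= 0 -> clamp r = 0.
Proof.
by move=> r0; rewrite /clamp min_l ?max_l // (le_trans r0) ?ler01.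
Qed.

Lemma clamp_ge1 r : 1 <= r -> clamp r = 1.
Proof. by move=> r1; rewrite /clamp min_r // max_r ?ler01. Qed.

(** The step number [k] runs during the time interval from [k] to [k + 1].  At any
    time at most one step is in progress: those before it are complete and those
    after it are the identity. *)
Fixpoint flow (st : seq ({set V} * V)) (r : R) t : V -> R :=
  if st is (s, v) :: st' then flow st' (r - 1) (push s v (clamp r) t) else t.

Lemma flow0 st r t : r <= 0 -> flow st r t = t.
Proof.
elim: st r t => //= -[s v] st IH r t r0.
by rewrite clamp_le0 // push0 IH // subr_le0 (le_trans r0) ?ler01.
Qed.

Lemma sum_flow st r t : \sum_w flow st r t w = \sum_w t w.
Proof. by elim: st r t => //= -[s v] st IH r t; rewrite IH sum_push. Qed.

Lemma cone_sub N N' t : N \subset N' -> cone N' t -> cone N t.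
Proof. by move=> /fintype.subsetP NN' [t0 tN]; split=> // c /NN'; exact: tN. Qed.

(** While a step is in progress the later ones do not move, so it is enough that
    each step preserves the complex in which it takes place. *)
Lemma flow_cone N st r t : collapses N st -> cone N t -> cone N (flow st r t).
Proof.
elim: st N r t => //= -[s v] st IH N r t [s0 vs Nsv cst] tN.
have [r1|r1] := lerP 1 r.
  apply: cone_sub (finset.subsetUr [set s]%SET N) _.
  by apply: IH => //; rewrite clamp_ge1 //; apply: push1_cone.
rewrite flow0 ?subr_le0 ?ltW //.
by apply: push_cone => //; exact: clamp_itv.
Qed.

Lemma flow_end N st r t : collapses N st -> (size st)%:R <= r -> cone N t ->
  forall s, s \in [seq x.1 | x <- st] -> exists2 u, u \in s & flow st r t u = 0.
Proof.
elim: st N r t => //= -[s v] st IH N r t [s0 vs Nsv cst] szr tN s'.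
have r1 : 1 <= r by rewrite (le_trans _ szr) // ler1n.
have pN : cone (s |: N) (push s v (clamp r) t).
  by rewrite clamp_ge1 //; apply: push1_cone.
rewrite inE => /orP[/eqP->|s'st].
  have [_] := flow_cone (r - 1) cst pN; apply.
  by rewrite !inE eqxx.
apply: IH cst _ pN _ s'st.
by rewrite lerBrDr natr1.
Qed.

Lemma push_continuous (T : topologicalType) s v (r : T -> R) (F : T -> V -> R) :
  continuous r -> (forall w, continuous (F^~ w)) ->
  forall w, continuous (fun x => push s v (r x) (F x) w).
Proof.
move=> cr cF w; have cm := @min_coord_continuous T s F cF.
by apply: contD; [apply: contB => //|]; apply: contM; do ?apply: contM => //; exact: cont_const.
Qed.

Lemma clamp_continuous (T : topologicalType) (r : T -> R) :
  continuous r -> continuous (fun x => clamp (r x)).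
Proof. by move=> cr; apply: cont_max; [|apply: cont_min => //]; exact: cont_const. Qed.

Lemma flow_continuous (T : topologicalType) st (r : T -> R) (F : T -> V -> R) :
  continuous r -> (forall w, continuous (F^~ w)) ->
  forall w, continuous (fun x => flow st (r x) (F x) w).
Proof.
elim: st r F => [|[s v] st IH] r F cr cF //=.
apply: (IH (fun x => r x - 1) (fun x => push s v (clamp (r x)) (F x))).
  by apply: contB => //; exact: cont_const.
by apply: push_continuous => //; exact: clamp_continuous.
Qed.

End Collapse.

(** * Extending the collapse to the removed facets *)

Section Deformation.
Local Open Scope classical_set_scope.
Local Open Scope ring_scope.
Context {R : realType} {V : finType}.
Variables (N : {set {set V}}) (I : finType) (dim : I -> nat).
Variable vert : forall i, 'I_(dim i).+1 -> V.

Definition facet i : {set V} := [set vert j | j : 'I_(dim i).+1]%SET.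
Hypothesis vert_inj : forall i, injective (@vert i).
Hypothesis facet_inj : injective facet.
Hypothesis facet_face : forall i c, c \in N -> ~~ (c \subset facet i).
Hypothesis facet_max :
  forall i v, v \notin facet i -> exists2 c, c \in N & c \subset v |: facet i.
Definition punctured : {set {set V}} := N :|: [set facet i | i : I]%SET.
Implicit Types (t : V -> R) (s : R).

Definition depth i t := min_coord (facet i) t.

Lemma facet_neq0 i : facet i != finset.set0.
Proof. by apply/set0Pn; exists (@vert i 0); apply: imset_f. Qed.

Lemma card_facet i : #|facet i| = (dim i).+1.
Proof. by rewrite (card_imset _ (@vert_inj i)) card_ord. Qed.

(** The interiors of the facets are disjoint and are detected by [depth]: by
    maximality, a face that contains a facet is equal to it. *)
Lemma depth_supp i t : cone N t -> depth i t != 0 -> forall v, (t v != 0) = (v \in facet i).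
Proof.
move=> [t0 tN] mt v; apply/idP/idP => [tv|vi]; last first.
  by apply: contraNneq mt => tv; apply/eqP/(min_coord0 t0 vi tv).
apply: contraNT mt => vi; have [c cN /fintype.subsetP cs] := facet_max vi.
have [u uc tu] := tN c cN.
move: (cs _ uc); rewrite !inE => /orP[/eqP uv|ui].
  by rewrite -uv tu eqxx in tv.
by apply/eqP/(min_coord0 t0 ui tu).
Qed.

Lemma depth_unique i j t : cone N t -> depth i t != 0 -> depth j t != 0 -> i = j.
Proof.
move=> tN mi mj; apply: facet_inj; apply/setP => v.
by rewrite -(depth_supp tN mi) (depth_supp tN mj).
Qed.

Lemma cone_punctured t : cone punctured t <-> cone N t /\ forall i, depth i t = 0.
Proof.
split=> [tL|[[t0 tN] mt]].
  split=> [|i]; first exact: cone_sub (finset.subsetUl _ _) tL.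
  have [t0 tN] := tL; have [|u ui tu] := tN (facet i); last exact: min_coord0 ui tu.
  by rewrite !inE imset_f ?orbT.
split=> // c /setUP[/tN//|/imsetP[i _ ->]].
have [u ui mu] := min_coord_attained t0 (facet_neq0 i).
by exists u => //; rewrite -mu; exact: mt.
Qed.

Lemma facet_dichotomy t : cone N t ->
  (forall i, depth i t = 0) \/ exists i, depth i t != 0 /\ forall j, j != i -> depth j t = 0.
Proof.
move=> tN; have [[i mi]|nE] := EM (exists i, depth i t != 0).
  right; exists i; split=> // j ji; apply/eqP; apply: contraNT ji => mj.
  by apply/eqP; exact: depth_unique tN mj mi.
by left=> i; apply/eqP; apply: contra_notT nE => mi; exists i.
Qed.

(** A point [t] of a facet is a combination of a boundary point and the
    barycentre: [core t] is the weight of the barycentre, and [outer t] is the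
    boundary point multiplied by its weight [1 - core t].  With this scaling
    [outer] is continuous at the barycentre. *)
Definition core t : R := \sum_i (dim i).+1%:R * depth i t.
Definition outer t : V -> R := fun v => t v - \sum_i depth i t * (v \in facet i)%:R.

Variables (st : seq ({set V} * V)) (v0 : V).
Hypothesis st_collapses : collapses punctured st.
Hypothesis st_end : forall v, v != v0 -> [set v]%SET \in [seq x.1 | x <- st].

(** The extension of [flow] from the punctured complex to the whole complex.  At
    time [s] a point with [2 * core t <= s] follows the path of its boundary
    point, of which it runs through the fraction [s - 2 * core t]; the points with
    larger core are spread radially over the whole facet.  Both descriptions agree
    where [2 * core t = s].  The formula covers all cases at once, and the
    denominator restores the total weight 1. *)
Definition deform s t : V -> R := fun v =>
  (flow st ((s - 2 * core t) * (size st)%:R) (outer t) v +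
   \sum_i Num.max 0 (depth i t - s / (2 * (dim i).+1%:R)) * (v \in facet i)%:R)
  / (1 - Num.min (core t) (s / 2)).

Lemma only_sum i (F : I -> R) : (forall j, j != i -> F j = 0) -> \sum_j F j = F i.
Proof. by move=> F0; rewrite (bigD1 i) //= big1 ?addr0. Qed.

Lemma core0 t : (forall i, depth i t = 0) -> core t = 0.
Proof. by move=> mt; rewrite /core big1 // => i _; rewrite mt mulr0. Qed.

Lemma outer_id t : (forall i, depth i t = 0) -> outer t = t.
Proof.
by move=> mt; apply/funext => v; rewrite /outer big1 ?subr0 // => i _; rewrite mt mul0r.
Qed.

Lemma deform_punctured s t : 0 <= s -> (forall i, depth i t = 0) ->
  deform s t = flow st (s * (size st)%:R) t.
Proof.
move=> s0 mt; apply/funext => v.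
rewrite /deform core0 // outer_id // mulr0 subr0 min_l ?divr_ge0 // subr0 divr1.
rewrite big1 ?addr0 // => i _; rewrite mt max_l ?mul0r // sub0r oppr_le0.
by rewrite divr_ge0 ?mulr_ge0.
Qed.

Section InsideFacet.
Variables (i : I) (t : V -> R).
Hypothesis (tN : cone N t) (t1 : \sum_v t v = 1).
Hypotheses (mi : depth i t != 0) (mj : forall j, j != i -> depth j t = 0).

Lemma coreE : core t = (dim i).+1%:R * depth i t.
Proof. by apply: only_sum => j /mj->; rewrite mulr0. Qed.

Lemma outerE v : outer t v = t v - depth i t * (v \in facet i)%:R.
Proof. by rewrite /outer (only_sum (i := i)) // => j /mj->; rewrite mul0r. Qed.

Lemma sum_outer : \sum_v outer t v = 1 - core t.
Proof.
under eq_bigr do rewrite outerE.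
by rewrite sumrB t1 -mulr_sumr sum_indicator card_facet coreE mulrC.
Qed.

Lemma outer_ge0 v : 0 <= outer t v.
Proof.
rewrite outerE; case: (boolP (v \in facet i)) => vi; last first.
  by rewrite mulr0 subr0; case: tN.
by rewrite mulr1 subr_ge0; exact: min_coord_le.
Qed.

Lemma outer_le v : outer t v <= t v.
Proof.
rewrite outerE gerBl mulr_ge0 //; apply: min_coord_ge0; by case: tN.
Qed.

Lemma cone_outer : cone punctured (outer t).
Proof.
have [t0 tc] := tN.
split=> [|c]; first exact: outer_ge0.
case/setUP => [/tc[u uc tu]|/imsetP[j _ ->]].
  by exists u => //; apply/eqP; rewrite eq_le outer_ge0 -tu outer_le.
have [u uj mu] := min_coord_attained t0 (facet_neq0 j); exists u => //.
have [ij|/mj mj0] := eqVneq j i.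
  by rewrite outerE -ij uj mulr1 -mu subrr.
apply/eqP; rewrite eq_le outer_ge0 andbT.
by rewrite (le_trans (outer_le _)) // -mu -mj0.
Qed.

Lemma core_gt0 : 0 < core t.
Proof.
rewrite coreE mulr_gt0 // lt_neqAle eq_sym mi.
by apply: min_coord_ge0; case: tN.
Qed.

Lemma deform_inner s v : 0 <= s <= 1 -> s <= 2 * core t ->
  deform s t v = (t v - s / (2 * (dim i).+1%:R) * (v \in facet i)%:R) / (1 - s / 2).
Proof.
move=> /andP[s0 s1] sc; rewrite /deform flow0; last first.
  by rewrite mulr_le0_ge0 ?subr_le0.
rewrite min_r; last by rewrite ler_pdivrMr // mulrC.
congr (_ / _); rewrite (only_sum (i := i)); last first.
  move=> j /mj->; rewrite max_l ?mul0r // sub0r oppr_le0.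
  by rewrite divr_ge0 ?mulr_ge0.
rewrite outerE max_r; first by ring.
rewrite subr_ge0 ler_pdivrMr ?mulr_gt0 // (le_trans sc) // coreE.
by rewrite le_eqVlt; apply/orP; left; apply/eqP; ring.
Qed.

Lemma deform_outer s v : 0 <= s <= 1 -> 2 * core t <= s ->
  deform s t v = flow st ((s - 2 * core t) * (size st)%:R) (outer t) v / (1 - core t).
Proof.
move=> /andP[s0 s1] sc; rewrite /deform min_l; last by rewrite ler_pdivlMr // mulrC.
congr (_ / _); rewrite big1 ?addr0 // => j _.
rewrite max_l ?mul0r // subr_le0.
have [->|/mj->] := eqVneq j i; last by rewrite divr_ge0 ?mulr_ge0.
rewrite ler_pdivlMr ?mulr_gt0 // (le_trans _ sc) // coreE.
by rewrite le_eqVlt; apply/orP; left; apply/eqP; ring.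
Qed.

End InsideFacet.

Definition weights t := cone N t /\ \sum_v t v = 1.

Lemma weights_ext t t' : t =1 t' -> weights t -> weights t'.
Proof. by move=> /funext->. Qed.

Lemma deform0 t : weights t -> deform 0 t = t.
Proof.
move=> [tN t1]; have [mt|[i [mi mj]]] := facet_dichotomy tN.
  by rewrite deform_punctured // mul0r flow0.
apply/funext => v; rewrite (deform_inner mj) ?lexx ?ler01 //.
  by rewrite !mul0r !subr0 divr1.
by rewrite mulr_ge0 // ltW // (core_gt0 tN mi mj).
Qed.

Lemma deform_weights_punctured s t : 0 <= s -> weights t -> (forall i, depth i t = 0) ->
  weights (deform s t) /\ forall i, depth i (deform s t) = 0.
Proof.
move=> s0 [tN t1] mt; rewrite deform_punctured //.
have tL : cone punctured t by apply/cone_punctured.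
have /cone_punctured[fN fm] := flow_cone (s * (size st)%:R) st_collapses tL.
by split=> //; split=> //; rewrite sum_flow.
Qed.

(** A point that is not in the interior of a facet stays in the punctured complex.
    Inside a facet, the point stays there as long as it belongs to the inner part,
    and moves along [flow] in the punctured complex afterwards. *)
Lemma deform_weights s t : 0 <= s <= 1 -> weights t -> weights (deform s t).
Proof.
move=> s01 [tN t1]; have [s0 s1] := andP s01.
have [mt|[i [mi mj]]] := facet_dichotomy tN.
  exact: (proj1 (deform_weights_punctured s0 (conj tN t1) mt)).
have [sc|sc] := lerP s (2 * core t).
  apply: (weights_ext (fun v => esym (deform_inner mj v s01 sc))).
  have d0 : 0 < 1 - s / 2 by lra.
  have vi0 v : 0 <= t v - s / (2 * (dim i).+1%:R) * (v \in facet i)%:R.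
    case: (boolP (v \in facet i)) => vi; last by rewrite mulr0 subr0; case: tN.
    rewrite mulr1 subr_ge0 (le_trans _ (min_coord_le t vi)) //.
    rewrite ler_pdivrMr ?mulr_gt0 // (le_trans sc) // (coreE mj).
    by rewrite le_eqVlt; apply/orP; left; apply/eqP; rewrite /depth; ring.
  split; first split.
  - by move=> v; rewrite divr_ge0 // ltW.
  - move=> c cN; have [t0 tc] := tN; have [u uc tu] := tc c cN; exists u => //.
    have: u \notin facet i by rewrite -(depth_supp tN mi) tu eqxx.
    by rewrite tu => /negPf->; rewrite mulr0 subr0 mul0r.
  - rewrite -mulr_suml sumrB t1 -mulr_sumr sum_indicator card_facet.
    rewrite (_ : _ * (dim i).+1%:R = s / 2) ?divff ?gt_eqF //.
    by rewrite invfM mulrA mulfVK ?pnatr_eq0.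
apply: (weights_ext (fun v => esym (deform_outer mj v s01 (ltW sc)))).
have d0 : 0 < 1 - core t by lra.
have := flow_cone ((s - 2 * core t) * (size st)%:R) st_collapses (cone_outer tN mj).
move=> /cone_punctured[[f0 fN] _]; split; first split.
- by move=> v; rewrite divr_ge0 // ltW.
- by move=> c /fN[u uc fu]; exists u => //; rewrite fu mul0r.
- by rewrite -mulr_suml sum_flow (sum_outer t1 mj) divff ?gt_eqF.
Qed.

Lemma deform1 t : weights t -> (forall i, depth i t = 0) -> deform 1 t = fun v => (v == v0)%:R.
Proof.
move=> [tN t1] mt; rewrite deform_punctured // mul1r.
have tL : cone punctured t by apply/cone_punctured.
have fe := flow_end st_collapses (lexx _) tL.
have f0 v : v != v0 -> flow st (size st)%:R t v = 0.
  by move=> /st_end /fe[u]; rewrite inE => /eqP->.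
apply/funext => v; have [->|vv0] := eqVneq v v0; last by rewrite f0.
have := sum_flow st (size st)%:R t; rewrite t1 (bigD1 v0) //= big1 ?addr0 //.
Qed.

Lemma depth_continuous (T : topologicalType) (F : T -> V -> R) i :
  (forall w, continuous (F^~ w)) -> continuous (fun x => depth i (F x)).
Proof. by move=> cF; apply: min_coord_continuous. Qed.

Lemma deform_continuous (T : topologicalType) (s : T -> R) (F : T -> V -> R) :
  continuous s -> (forall w, continuous (F^~ w)) -> (forall x, 0 <= s x <= 1) ->
  forall w, continuous (fun x => deform (s x) (F x) w).
Proof.
move=> cs cF s01 w.
have cc : continuous (fun x => core (F x)).
  apply: (@cont_sum R T I _ _ (fun i x => (dim i).+1%:R * depth i (F x))) => i.
  by apply: contM; [exact: cont_const|exact: depth_continuous].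
apply: contM.
  apply: contD.
    apply: (@flow_continuous R V T st (fun x => (s x - 2 * core (F x)) * (size st)%:R)
        (fun x => outer (F x))).
      by apply: contM; [apply: contB => //; apply: contM => //|]; exact: cont_const.
    move=> v; apply: contB => //.
    apply: (@cont_sum R T I _ _ (fun i x => depth i (F x) * (v \in facet i)%:R)) => i.
    by apply: contM; [exact: depth_continuous|exact: cont_const].
  apply: (@cont_sum R T I _ _ (fun i x => Num.max 0 (depth i (F x) - s x / (2 * (dim i).+1%:R)) * (w \in facet i)%:R)) => i.
  apply: contM; last exact: cont_const.
  apply: cont_max; first exact: cont_const.
  by apply: contB; [exact: depth_continuous|apply: contM => //; exact: cont_const].
apply: contV => [x|].
  have : Num.min (core (F x)) (s x / 2) <= s x / 2 by rewrite ge_min lexx orbT.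
  by move: (s01 x) => /andP[? ?] ?; rewrite gt_eqF //; lra.
apply: contB; first exact: cont_const.
by apply: cont_min => //; apply: contM => //; exact: cont_const.
Qed.

End Deformation.

(** * Pinching the boundary of a simplex to a point *)

Section Pinching.
Local Open Scope classical_set_scope.
Local Open Scope ring_scope.
Context {R : realType} {V : finType}.
Variables (n : nat) (vert : 'I_n.+1 -> V).
Hypothesis vert_inj : injective vert.
Implicit Types (t : V -> R).
Local Notation F := [set vert j | j : 'I_n.+1]%SET.
Local Notation m t := (min_coord F t).

(** Up to scaling, [m t] and the differences [t (vert j) - t (vert 0)] are
    coordinates on the simplex, and their quotients identify its interior with the
    Euclidean space of dimension [n]; [pinch] is this map followed by inverse
    stereographic projection from the pole.  Multiplying out the denominators
    makes the formula meaningful on the boundary.  The term [excess t], which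
    vanishes on the simplex, keeps the denominator positive on the rest of the
    complex. *)
Definition excess t : R := \sum_(v | v \notin F) t v.
Definition spread t : R := \sum_j (t (vert j) - t (vert 0)) ^+ 2 + excess t ^+ 2.
Definition pinch t : 'rV[R]_n.+1 := \row_j
  ((if j == 0 then spread t - m t ^+ 2 else 2 * m t * (t (vert j) - t (vert 0)))
   / (spread t + m t ^+ 2)).

(** What [pinch] needs to know about the points of a complex of which the simplex
    is a facet. *)
Definition admissible t := [/\ forall v, 0 <= t v, \sum_v t v = 1
   & m t != 0 -> forall v, v \notin F -> t v = 0].

Lemma spread_ge0 t : 0 <= spread t.
Proof. by rewrite addr_ge0 ?sqr_ge0 // sumr_ge0 // => j _; exact: sqr_ge0. Qed.

Lemma vert_in j : vert j \in F. Proof. exact: imset_f. Qed.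

Lemma denom_gt0 t : admissible t -> 0 < spread t + m t ^+ 2.
Proof.
move=> [t0 t1 _]; rewrite lt_neqAle addr_ge0 ?spread_ge0 ?sqr_ge0 // andbT eq_sym.
apply/eqP => /eqP; rewrite paddr_eq0 ?spread_ge0 ?sqr_ge0 // sqrf_eq0 => /andP[sk /eqP mt].
have dj j : t (vert j) = t (vert 0).
  move: sk; rewrite /spread paddr_eq0 ?sqr_ge0 ?sumr_ge0 // => [/andP[+ _]|k _]; last exact: sqr_ge0.
  rewrite psumr_eq0 => [/allP/(_ j)|k _]; last exact: sqr_ge0.
  by rewrite mem_index_enum sqrf_eq0 subr_eq0 => /(_ isT)/eqP.
have ex : excess t = 0.
  move: sk; rewrite /spread paddr_eq0 ?sqr_ge0 ?sumr_ge0 // => [/andP[_]|k _]; last exact: sqr_ge0.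
  by rewrite sqrf_eq0 => /eqP.
have F0 : F != finset.set0 by apply/set0Pn; exists (vert 0); exact: vert_in.
have [u /imsetP[j _ ->] mu] := min_coord_attained t0 F0.
have tF v : v \in F -> t v = 0 by case/imsetP=> k _ ->; rewrite dj -(dj j) -mu.
move: t1; rewrite (bigID (mem F)) /= big1 // add0r.
by rewrite -/(excess t) ex => /eqP; rewrite eq_sym oner_eq0.
Qed.

Lemma min_coord_excess t : admissible t -> m t * excess t = 0.
Proof.
move=> [_ _ ta]; have [->|/ta tF] := eqVneq (m t) 0; first by rewrite mul0r.
by rewrite /excess big1 ?mulr0.
Qed.

Lemma pinch_sphere t : admissible t -> sphere R n (pinch t).
Proof.
move=> ta; rewrite /sphere /= (bigD1 0) //= mxE eqxx.
under eq_bigr => j j0 do rewrite mxE (negPf j0).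
have D0 := denom_gt0 ta; set D := spread t + _ in D0 *.
under eq_bigr do rewrite expr_div_n exprMn.
rewrite -mulr_suml -mulr_sumr expr_div_n -mulrDl.
have -> : \sum_(j < n.+1 | j != 0) (t (vert j) - t (vert 0)) ^+ 2 = spread t - excess t ^+ 2.
  by rewrite /spread addrK [RHS](bigD1 0) //= subrr expr0n add0r.
have -> : (spread t - m t ^+ 2) ^+ 2 + (2 * m t) ^+ 2 * (spread t - excess t ^+ 2) =
   D ^+ 2 - 4 * (m t * excess t) ^+ 2 by rewrite /D; ring.
by rewrite (min_coord_excess ta) expr0n mulr0 subr0 divff // expf_neq0 // gt_eqF.
Qed.

Lemma pinch_pole t : admissible t -> (pinch t == delta_mx 0 0) = (m t == 0).
Proof.
move=> ta; have D0 := denom_gt0 ta; apply/eqP/eqP => [/rowP/(_ 0)|mt].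
  rewrite !mxE !eqxx /= => /(congr1 ( *%R^~ (spread t + m t ^+ 2))).
  rewrite divfK ?gt_eqF // mul1r => /eqP; rewrite -subr_eq0.
  rewrite (_ : _ - _ = - (m t ^+ 2 *+ 2)); last by ring.
  by rewrite oppr_eq0 mulrn_eq0 /= sqrf_eq0 => /eqP.
move: D0; rewrite /pinch mt expr0n /= addr0 => D0.
apply/rowP => j; rewrite !mxE eqxx /=; case: eqP => [_|_].
  by rewrite subr0 divff ?gt_eqF.
by rewrite mulr0 !mul0r.
Qed.

(** Stereographic projection recovers the quotients of the coordinates. *)
Lemma pinch_slope t j : admissible t -> m t != 0 ->
  j != 0 -> pinch t 0 j / (1 - pinch t 0 0) = t (vert j) / m t - t (vert 0) / m t.
Proof.
move=> ta mt j0; have D0 := denom_gt0 ta; rewrite !mxE eqxx (negPf j0).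
have E : 1 - (spread t - m t ^+ 2) / (spread t + m t ^+ 2) = 2 * m t ^+ 2 / (spread t + m t ^+ 2).
  by field; rewrite gt_eqF.
rewrite E; set D := spread t + m t ^+ 2 in D0 *; set mm := m t in mt *.
by field; rewrite mt gt_eqF.
Qed.

(** The quotients [t v / m t] of two points with the same image differ by a
    constant.  As the smallest of them is 1 for both points, the constant is 0;
    then the points are proportional, hence equal. *)
Lemma pinch_inj t t' : admissible t -> admissible t' -> m t != 0 -> pinch t = pinch t' -> t = t'.
Proof.
move=> ta ta' mt pE.
have mt' : m t' != 0 by rewrite -pinch_pole // -pE pinch_pole.
have [t0 t1 /(_ mt) tF] := ta; have [t0' t1' /(_ mt') tF'] := ta'.
have gt0 (s : V -> R) : (forall v, 0 <= s v) -> m s != 0 -> 0 < m s.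
  by move=> s0 ms; rewrite lt_neqAle eq_sym ms min_coord_ge0.
have m0 := gt0 _ t0 mt; have m0' := gt0 _ t0' mt'.
pose k := t (vert 0) / m t - t' (vert 0) / m t'.
have kE v : v \in F -> t v / m t - t' v / m t' = k.
  case/imsetP=> j _ ->; have [->//|j0] := eqVneq j 0.
  by have := pinch_slope ta' mt' j0; rewrite -pE (pinch_slope ta mt j0) /k => E; lra.
have F0 : F != finset.set0 by apply/set0Pn; exists (vert 0); exact: vert_in.
have le1 (s : V -> R) v : (forall v, 0 <= s v) -> m s != 0 -> v \in F -> 1 <= s v / m s.
  by move=> s0 ms vF; rewrite ler_pdivlMr ?gt0 // mul1r; exact: min_coord_le.
have k0 : k = 0.
  have [u uF mu] := min_coord_attained t0 F0; have [w wF mw] := min_coord_attained t0' F0.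
  have := kE u uF; rewrite -mu divff // => ku.
  have := kE w wF; rewrite -mw divff // => kw.
  by have := le1 _ _ t0' mt' uF; have := le1 _ _ t0 mt wF; lra.
have tt' v : t v = t' v * (m t / m t').
  have [vF|vF] := boolP (v \in F); last by rewrite tF // tF' // mul0r.
  have /eqP := kE v vF; rewrite k0 subr_eq0 => /eqP E.
  by rewrite -[LHS](divfK mt) E; ring.
apply/funext => v; rewrite tt'.
have : \sum_v t v = (\sum_v t' v) * (m t / m t').
  by rewrite mulr_suml; apply: eq_bigr => w _; rewrite tt'.
by rewrite t1 t1' mul1r => <-; rewrite mulr1.
Qed.

Lemma pinch_surj (x : 'rV[R]_n.+1) : sphere R n x -> x != delta_mx 0 0 ->
  exists t, [/\ admissible t, m t != 0, (forall v, v \notin F -> t v = 0) & pinch t = x].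
Proof.
move=> x1 xp.
have x0le : x 0 0 < 1.
  have sq : x 0 0 ^+ 2 + \sum_(j < n.+1 | j != 0) x 0 j ^+ 2 = 1.
    by rewrite -[RHS]x1 [RHS](bigD1 0).
  have S0 : 0 <= \sum_(j < n.+1 | j != 0) x 0 j ^+ 2 by apply: sumr_ge0 => j _; exact: sqr_ge0.
  have x0le1 : x 0 0 <= 1 by nra.
  rewrite lt_neqAle x0le1 andbT; apply: contra_neqN xp => /eqP x01.
  have: \sum_(j < n.+1 | j != 0) x 0 j ^+ 2 == 0 by apply/eqP; move: sq; rewrite x01; lra.
  rewrite psumr_eq0 => [/allP xz|j _]; last exact: sqr_ge0.
  apply/rowP => j; rewrite mxE eqxx /=; case: eqVneq => [->//|j0].
  by have := xz j (mem_index_enum _); rewrite j0 /= sqrf_eq0 => /eqP.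
(* The stereographic coordinates of x, with a coordinate 0 added at the vertex 0. *)
pose z j := if j == 0 then 0 else x 0 j / (1 - x 0 0).
have [k kz] : exists k, forall j, z k <= z j.
  by exists [arg min_(j < 0) z j]%O; case: arg_minP => // k _ kz j; exact: kz.
(* Normalized so that the smallest of the [a j] is 1, like the quotients t v / m t. *)
pose a j := 1 + z j - z k.
have a1 j : 1 <= a j by rewrite /a -addrA lerDl subr_ge0.
have a0 j : 0 < a j by exact: lt_le_trans (a1 j).
pose S := \sum_j a j.
have S0 : 0 < S by rewrite /S (bigD1 0) //= ltr_wpDr // sumr_ge0 // => j _; exact: ltW.
pose t v := \sum_j (a j / S) * (v == vert j)%:R.
have tvert j : t (vert j) = a j / S.
  rewrite /t (bigD1 j) //= eqxx mulr1 big1 ?addr0 // => i ij.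
  by rewrite (inj_eq vert_inj) eq_sym (negPf ij) mulr0.
have toff v : v \notin F -> t v = 0.
  move=> vF; rewrite /t big1 // => j _; rewrite (_ : v == vert j = false) ?mulr0 //.
  by apply: contraNF vF => /eqP->; exact: vert_in.
have t0 v : 0 <= t v.
  by rewrite /t sumr_ge0 // => j _; rewrite mulr_ge0 // divr_ge0 // ltW.
have ta : admissible t.
  split=> //.
  rewrite /t exchange_big /=; under eq_bigr do rewrite -mulr_sumr sum_point mulr1.
  by rewrite -mulr_suml divff ?gt_eqF.
have F0 : F != finset.set0 by apply/set0Pn; exists (vert 0); exact: vert_in.
have mE : m t = S^-1.
  apply/eqP; rewrite eq_le; apply/andP; split.
    rewrite (le_trans (min_coord_le t (vert_in k))) // tvert /a addrK.
    by rewrite mul1r.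
  have [u /imsetP[j _ ->] ->] := min_coord_attained t0 F0.
  by rewrite tvert -[leLHS]mul1r ler_pM2r ?invr_gt0.
have mt : m t != 0 by rewrite mE invr_eq0 gt_eqF.
exists t; split=> //.
have ex : excess t = 0 by rewrite /excess big1.
have y j : t (vert j) - t (vert 0) = z j / S.
  by rewrite !tvert /a /z eqxx -mulrBl; congr (_ / _); ring.
have sk : spread t = (1 + x 0 0) / (1 - x 0 0) / S ^+ 2.
  rewrite /spread ex expr0n addr0; under eq_bigr do rewrite y expr_div_n.
  rewrite -mulr_suml; congr (_ / _).
  rewrite (bigD1 0) //= {1}/z eqxx expr0n add0r.
  rewrite (eq_bigr (fun j => x 0 j ^+ 2 / (1 - x 0 0) ^+ 2)); last first.
    by move=> j j0; rewrite /z (negPf j0) expr_div_n.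
  rewrite -mulr_suml.
  have -> : \sum_(j < n.+1 | j != 0) x 0 j ^+ 2 = 1 - x 0 0 ^+ 2.
    by move: x1; rewrite /sphere /= (bigD1 0) //= => <-; ring.
  by field; rewrite gt_eqF // subr_gt0.
apply/rowP => j; rewrite mxE y sk mE.
have x0 : 1 - x 0 0 != 0 by rewrite gt_eqF // subr_gt0.
have Sn : S != 0 by rewrite gt_eqF.
have [->|j0] := eqVneq j 0.
  by field; rewrite x0 Sn (_ : _ + _ = 2) ?pnatr_eq0 //; ring.
rewrite /z (negPf j0).
by field; rewrite x0 Sn (_ : _ + _ = 2) ?pnatr_eq0 //; ring.
Qed.

Lemma pinch_continuous (T : topologicalType) (G : T -> V -> R) :
  (forall v, continuous (G^~ v)) -> (forall x, admissible (G x)) ->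
  continuous (fun x => pinch (G x)).
Proof.
move=> cG Ga; apply: cont_rV => j.
have cm := @min_coord_continuous R V T F G cG.
have cm2 : continuous (fun x => m (G x) ^+ 2) by apply: contM.
have cspread : continuous (fun x => spread (G x)).
  apply: contD.
    apply: (@cont_sum R T _ _ _ (fun j x => (G x (vert j) - G x (vert 0)) ^+ 2)) => i.
    by apply: contM; apply: contB.
  by apply: contM; apply: (@cont_sum R T _ _ _ (fun v x => G x v)).
rewrite (_ : (fun x => _) = fun x =>
  (if j == 0 then spread (G x) - m (G x) ^+ 2 else 2 * m (G x) * (G x (vert j) - G x (vert 0)))
   / (spread (G x) + m (G x) ^+ 2)); last by apply/funext => x; rewrite mxE.
apply: contM.
  case: (j == 0); first exact: contB.
  apply: contM; [apply: contM => //; exact: cont_const|exact: contB].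
apply: contV => [x|]; last exact: contD.
by rewrite gt_eqF // denom_gt0.
Qed.

End Pinching.

(** * A complex that collapses after the removal of facets *)

Section WedgeTheorem.
Local Open Scope classical_set_scope.
Local Open Scope ring_scope.

(** A finite wedge embeds in the product of its summands, so continuity can be
    checked on each summand. *)
Lemma continuous_wedge (T : topologicalType) (I : finType) (Y : I -> topologicalType)
    (p : forall i, Y i) (f : T -> wedge p) :
  (forall i, topology_structure.closed [set p i]) ->
  (forall i, continuous (fun x => wedge_prod (f x) i)) -> continuous f.
Proof.
move=> clp cf x A nA.
have cwf : continuous (fun x => wedge_prod (f x)).
  exact: (@cont_prod T I Y).
have := wedge_prod_open (@finite_finset I classical_sets.setT) clp nA.
case/(nbhs_subspace_ex _ _); first by exists (f x).
move=> U nU UA; apply: (@filterS _ (nbhs x) _ ((fun x => wedge_prod (f x)) @^-1` U)) => [y Uy|]; last exact: cwf.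
have : (U `&` range (@wedge_prod I Y p)) (wedge_prod (f y)) by split=> //; exists (f y).
rewrite -UA => -[[z Az zE] _]; by rewrite /= -(wedge_prod_inj zE).
Qed.

Lemma sphere_hausdorff (R : realType) n : hausdorff_space (sphere R n).
Proof. by apply: hausdorff_set_type; exact: norm_hausdorff. Qed.

Lemma unit_interval_compact (R : realType) : compact [set: @unit_interval R].
Proof. by apply: compact_set_type; exact: segment_compact. Qed.

Lemma unit_intervalP (R : realType) (s : @unit_interval R) : 0 <= val s <= 1.
Proof. by have := set_valP s; rewrite /unit_interval /= in_itv. Qed.

Lemma flip_proof (R : realType) (s : @unit_interval R) : 1 - val s \in @unit_interval R.
Proof.
have /andP[s0 s1] := unit_intervalP s.
by apply: mem_set; rewrite /unit_interval /= in_itv /= subr_ge0 s1 gerBl s0.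
Qed.

(** The deformation starts at the identity, whereas the required homotopies end
    there. *)
Definition flip (R : realType) (s : @unit_interval R) : @unit_interval R :=
  exist _ (1 - val s) (flip_proof s).

Section Main.
Context {R : realType} {V : finType}.
Variables (N : {set {set V}}) (I : finType) (dim : I -> nat).
Variable vert : forall i, 'I_(dim i).+1 -> V.
Arguments vert : clear implicits.
Variables (i0 : I) (st : seq ({set V} * V)) (v0 : V).
Hypothesis vert_inj : forall i, injective (vert i).
Hypothesis facet_inj : injective (facet vert).
Hypothesis facet_face : forall i c, c \in N -> ~~ (c \subset facet vert i).
Hypothesis facet_max :
  forall i v, v \notin facet vert i -> exists2 c, c \in N & c \subset v |: facet vert i.
Hypothesis st_collapses : collapses (punctured N vert) st.
Hypothesis st_end : forall v, v != v0 -> [set v]%SET \in [seq x.1 | x <- st].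
Hypothesis v0_punctured : forall c, c \in punctured N vert -> ~~ (c \subset [set v0]%SET).

Definition faces : {set {set V}} :=
  [set s | (s != finset.set0) && [forall c in N, ~~ (c \subset s)]]%SET.

Let X := realization R faces.
Let W := sphere_wedge R dim.

Lemma N_neq0 c : c \in N -> c != finset.set0.
Proof.
by move=> cN; apply: contraNneq (facet_face i0 cN) => ->; rewrite finset.sub0set.
Qed.

Lemma realizationP (t : {ptws V -> R}) : realization_set R faces t <-> weights N t.
Proof.
split=> [[t0 t1]|[[t0 tN] t1]].
  rewrite inE => /andP[_ /forall_inP tN]; split=> //; split=> // c /tN.
  move=> /fintype.subsetPn[u uc]; rewrite inE negbK => /eqP tu.
  by exists u.
split=> //; rewrite inE; apply/andP; split.
  apply/negP => /eqP ts; move: t1; rewrite big1 => [/eqP|v _].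
    by rewrite eq_sym oner_eq0.
  by apply/eqP; apply/negPn/negP => tv; have := finset.in_set0 v; rewrite -ts inE tv.
apply/forall_inP => c /tN[u uc tu].
by apply/fintype.subsetPn; exists u => //; rewrite inE negbK tu.
Qed.

Definition point_of (t : {ptws V -> R}) (tr : weights N t) : X :=
  exist _ t (mem_set ((realizationP t).2 tr)).

Lemma weights_admissible (t : V -> R) i : weights N t -> admissible (vert i) t.
Proof.
move=> [tN t1]; split=> // [|mt v vi]; first by case: tN.
by apply/eqP/negPn; rewrite (depth_supp facet_max tN mt) vi.
Qed.

Lemma realizationV (x : X) : weights N (val x).
Proof. exact/realizationP/set_valP. Qed.

Lemma to_sphere_proof i (x : X) : pinch (vert i) (val x) \in sphere R (dim i).
Proof. by apply: mem_set; apply: pinch_sphere; apply: weights_admissible; exact: realizationV. Qed.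

Definition to_sphere i (x : X) : sphere R (dim i) :=
  exist _ (pinch (vert i) (val x)) (to_sphere_proof i x).

Lemma to_sphere_pole i x : (to_sphere i x = sphere_pole R (dim i)) <-> depth vert i (val x) = 0.
Proof.
have pE := pinch_pole (weights_admissible i (realizationV x)).
split=> [/(congr1 val) /eqP|mx]; last by apply/val_inj/eqP; rewrite pE; exact/eqP.
by rewrite pE => /eqP.
Qed.

Lemma to_sphere_continuous i : continuous (to_sphere i).
Proof.
apply: cont_set_type => /=.
apply: (@pinch_continuous R V _ (vert i) X (fun x => val x)) => [v|x].
  move=> x; apply: (@continuous_comp _ _ _ (fun x : X => val x) (fun t : {ptws V -> R} => t v)).
    exact: cont_val.
  exact: cont_eval.
exact: weights_admissible (realizationV x).
Qed.

(** The facet whose interior contains [x]; the default [i0] is harmless, since all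
    points of the punctured complex are mapped to the common base point. *)
Definition cell (x : X) : I := odflt i0 [pick i | depth vert i (val x) != 0].

Definition to_wedge (x : X) : W :=
  wedge_lift (fun i => sphere_pole R (dim i)) (to_sphere (cell x) x).

Lemma to_wedge_prod x : wedge_prod (to_wedge x) = fun i => to_sphere i x.
Proof.
rewrite /wedge_prod wedge_lift_funE; last exact: wedge_prod_pointE.
apply: functional_extensionality_dep => i.
case: dfwithP => // j; rewrite /cell; case: pickP => [k mk /= kj|mx _].
  apply/esym/to_sphere_pole/eqP; apply: contraNT kj => mj.
  by apply/eqP; exact: (depth_unique facet_inj facet_max (proj1 (realizationV x)) mk mj).
by apply/esym/to_sphere_pole/eqP; have /negbFE := mx j.
Qed.

Lemma pole_closed i : topology_structure.closed [set sphere_pole R (dim i)].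
Proof. by apply: accessible_closed_set1; apply: hausdorff_accessible; exact: sphere_hausdorff. Qed.

Lemma to_wedge_continuous : continuous to_wedge.
Proof.
apply: continuous_wedge; first exact: pole_closed.
move=> i; rewrite (_ : (fun x => _) = to_sphere i); first exact: to_sphere_continuous.
by apply/funext => x; rewrite to_wedge_prod.
Qed.

(** Together with [to_wedge_punctured] and [to_wedge_surj]: the wedge is the
    quotient of the complex by the punctured complex. *)
Lemma to_wedge_eq x x' : to_wedge x = to_wedge x' ->
  x = x' \/ (forall i, depth vert i (val x) = 0) /\ (forall i, depth vert i (val x') = 0).
Proof.
move=> E; have sphereE i : to_sphere i x = to_sphere i x'.
  by have := congr1 (fun w => wedge_prod w i) E; rewrite !to_wedge_prod.
have [mx|[i [mi _]]] := facet_dichotomy facet_inj facet_max (proj1 (realizationV x)).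
  by right; split=> // i; apply/to_sphere_pole; rewrite -sphereE; exact/to_sphere_pole.
left; apply/val_inj; apply: (pinch_inj (weights_admissible i (realizationV x))
  (weights_admissible i (realizationV x')) mi).
exact: (congr1 (fun a : sphere R (dim i) => val a) (sphereE i)).
Qed.

Lemma vertex_weights : weights N (fun v => (v == v0)%:R : R) /\
  forall i, depth vert i (fun v => (v == v0)%:R : R) = 0.
Proof.
have [] : cone N (fun v => (v == v0)%:R : R) /\ forall i, depth vert i (fun v => (v == v0)%:R : R) = 0.
  apply/cone_punctured; split=> // c /v0_punctured /fintype.subsetPn[u uc uv].
  by exists u => //; move: uv; rewrite inE => /negPf->.
by move=> ? ?; split=> //; split=> //; exact: sum_point.
Qed.

Lemma to_wedge_surj (y : W) : exists x, to_wedge x = y.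
Proof.
have base_pt i : exists x, to_wedge x = wedge_lift (fun i => sphere_pole R (dim i)) (sphere_pole R (dim i)).
  have [vr vm] := vertex_weights.
  exists (point_of vr).
  apply: wedge_prod_inj; rewrite to_wedge_prod /wedge_prod wedge_lift_funE; last exact: wedge_prod_pointE.
  apply: functional_extensionality_dep => j.
  by case: dfwithP => [|k _]; apply/to_sphere_pole; exact: vm.
case: (wedge_nbhs_specP y pole_closed) => [i|i a ap]; first exact: base_pt.
have [|t [ta mt toff pt]] := pinch_surj (@vert_inj i) (set_valP a).
  by apply: contraNneq ap => pa; apply/eqP/val_inj.
have tr : weights N t.
  have [t0 t1 _] := ta; split=> //; split=> // c cN.
  by have /fintype.subsetPn[u uc ui] := facet_face i cN; exists u => //; exact: toff.
exists (point_of tr).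
apply: wedge_prod_inj; rewrite to_wedge_prod /wedge_prod wedge_lift_funE; last exact: wedge_prod_pointE.
apply: functional_extensionality_dep => j.
case: dfwithP => [|k ik]; first exact: val_inj.
apply/to_sphere_pole/eqP; apply: contraNT ik => mk.
by apply/eqP; exact: (depth_unique facet_inj facet_max (proj1 tr) mt mk).
Qed.

Lemma slide_proof (s : @unit_interval R) (x : X) :
  deform vert st (val s) (val x) \in realization_set R faces.
Proof.
by apply: mem_set; apply/realizationP; apply: deform_weights => //;
  [exact: unit_intervalP|exact: realizationV].
Qed.

Definition slide (x : X) (s : @unit_interval R) : X :=
  exist _ (deform vert st (val s) (val x)) (slide_proof s x).

Lemma slide_continuous : continuous (fun p : X * @unit_interval R => slide p.1 p.2).
Proof.
apply: cont_set_type; apply: cont_ptws => v.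
apply: (@deform_continuous R V I dim vert st _ (fun p : X * @unit_interval R => val p.2)
   (fun p => val p.1)) => [p|w p|p]; last exact: unit_intervalP.
  by apply: (@continuous_comp _ _ _ snd); [exact: cvg_snd|exact: cont_val].
apply: (@continuous_comp _ _ _ (fun p : X * @unit_interval R => val p.1)
  (fun t : {ptws V -> R} => t w)); last exact: cont_eval.
by apply: (@continuous_comp _ _ _ fst); [exact: cvg_fst|exact: cont_val].
Qed.

Lemma slide0 x : slide x (ui0 R) = x.
Proof. by apply/val_inj; apply: (deform0 facet_inj facet_max); exact: realizationV. Qed.

Lemma slide1 x x' : (forall i, depth vert i (val x) = 0) -> (forall i, depth vert i (val x') = 0) ->
  slide x (ui1 R) = slide x' (ui1 R).
Proof.
by move=> mx mx'; apply/val_inj; rewrite /= !(deform1 st_collapses st_end) //; exact: realizationV.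
Qed.

Lemma slide_punctured s x : (forall i, depth vert i (val x) = 0) ->
  forall i, depth vert i (val (slide x s)) = 0.
Proof.
move=> mx; have /andP[s0 _] := unit_intervalP s.
exact: (proj2 (deform_weights_punctured st_collapses s0 (realizationV x) mx)).
Qed.

Lemma to_wedge_punctured x x' : (forall i, depth vert i (val x) = 0) -> (forall i, depth vert i (val x') = 0) ->
  to_wedge x = to_wedge x'.
Proof.
move=> mx mx'; apply: wedge_prod_inj; rewrite !to_wedge_prod.
apply: functional_extensionality_dep => i.
by rewrite ((to_sphere_pole i x).2 (mx i)) ((to_sphere_pole i x').2 (mx' i)).
Qed.

Lemma realization_compact : compact [set: X].
Proof.
apply: compact_set_type.
(* A sum of squares whose zeros in the cube are the points of the realization. *)
pose g (t : {ptws V -> R}) := (\sum_v t v - 1) ^+ 2 + \sum_(c in N) min_coord c t ^+ 2.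
have cm c : continuous (fun t : {ptws V -> R} => min_coord c t).
  by apply: min_coord_continuous => v; exact: cont_eval.
have cg : continuous g.
  apply: contD.
    have cs : continuous (fun t : {ptws V -> R} => \sum_v t v - 1).
      apply: contB; last exact: cont_const.
      by apply: (@cont_sum R _ _ _ _ (fun v (t : {ptws V -> R}) => t v)) => v; exact: cont_eval.
    exact: contM.
  by apply: (@cont_sum R _ _ _ _ (fun c (t : {ptws V -> R}) => min_coord c t ^+ 2)) => c; exact: contM.
have -> : realization_set R faces =
    [set t : {ptws V -> R} | forall v, `[0, 1]%classic (t v)] `&` (g @^-1` [set 0]).
  rewrite classical_sets.eqEsubset; split=> t.
    move=> /realizationP[[t0 tN] t1]; split.
      move=> v; rewrite /= in_itv /= t0 /= -t1 (bigD1 v) //= lerDl.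
      exact: sumr_ge0.
    rewrite /g /= t1 subrr expr0n add0r big1 // => c /tN[u uc tu].
    by rewrite (min_coord0 t0 uc tu) expr0n.
  move=> [t01 /eqP]; have t0 v : 0 <= t v by have := t01 v; rewrite /= in_itv => /andP[].
  rewrite /g paddr_eq0 ?sqr_ge0 ?sumr_ge0 //; last by move=> *; exact: sqr_ge0.
  rewrite sqrf_eq0 subr_eq0 psumr_eq0; last by move=> *; exact: sqr_ge0.
  move=> /andP[/eqP t1 /allP tN]; apply/realizationP; split=> //; split=> // c cN.
  have [u uc mu] := min_coord_attained t0 (N_neq0 cN); exists u => //.
  by have := tN c (mem_index_enum _); rewrite cN sqrf_eq0 -mu => /eqP.
apply: compact_closedI.
  by apply: (@tychonoff V (fun=> R) (fun=> `[0, 1]%classic)) => v; exact: segment_compact.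
move/continuous_closedP: cg; apply.
by apply: accessible_closed_set1; apply: hausdorff_accessible; exact: Rhausdorff.
Qed.

Lemma wedge_of_spheres_hausdorff : hausdorff_space W.
Proof. by apply: wedge_hausdorff => i; exact: sphere_hausdorff. Qed.

Definition preimage_pt (y : W) : X := projT1 (cid (to_wedge_surj y)).
Lemma preimage_ptK y : to_wedge (preimage_pt y) = y.
Proof. exact: projT2 (cid (to_wedge_surj y)). Qed.

Lemma flip_continuous : continuous (@flip R).
Proof. by apply: cont_set_type; apply: contB; [exact: cont_const|exact: cont_val]. Qed.

Lemma flip0 : flip (ui0 R) = ui1 R.
Proof. by apply/val_inj; rewrite /= subr0. Qed.

Lemma flip1 : flip (ui1 R) = ui0 R.
Proof. by apply/val_inj; rewrite /= subrr. Qed.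

(** The inverse equivalence sends a point of the wedge to the end of the
    deformation of any of its preimages: preimages differ only when they lie in
    the punctured complex, which ends at one point.  The composite on the complex
    is the end of [slide]; the composite on the wedge is the end of the image of
    [slide] under [to_wedge], which is well defined because [slide] preserves the
    punctured complex. *)
Theorem realization_wedge : homotopy_equivalent R X W.
Proof.
pose g y := slide (preimage_pt y) (ui1 R).
have rK x : slide (preimage_pt (to_wedge x)) (ui1 R) = slide x (ui1 R).
  by have [->//|[? ?]] := to_wedge_eq (preimage_ptK (to_wedge x)); exact: slide1.
have rE x s : to_wedge (slide (preimage_pt (to_wedge x)) s) = to_wedge (slide x s).
  have [->//|[? ?]] := to_wedge_eq (preimage_ptK (to_wedge x)).
  by apply: to_wedge_punctured; exact: slide_punctured.
have cslide1 : continuous (fun x => slide x (ui1 R)).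
  apply: (cont_comp _ slide_continuous (f := fun x => (x, ui1 R))).
  by apply: cont_pair; [exact: cont_id|exact: cont_const].
have cslide : continuous (fun p : X * @unit_interval R => slide p.1 (flip p.2)).
  apply: (cont_comp _ slide_continuous (f := fun p => (p.1, flip p.2))).
  apply: cont_pair; first exact: cont_fst.
  by apply: (cont_comp (@cont_snd _ _)); exact: flip_continuous.
exists to_wedge, g; split; first exact: to_wedge_continuous.
- apply: (compact_surj_quotient realization_compact wedge_of_spheres_hausdorff
    to_wedge_continuous to_wedge_surj).
  by rewrite (_ : g \o to_wedge = fun x => slide x (ui1 R)) //; apply/funext => x; exact: rK.
- exists (fun p => slide p.1 (flip p.2)); split=> // x /=.
    by rewrite flip0 /g rK.
  by rewrite flip1 slide0.
- exists (fun p => to_wedge (slide (preimage_pt p.1) (flip p.2))); split=> [|y|y] /=.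
  + apply: (@compact_surj_quotient (X * @unit_interval R)%type (W * @unit_interval R)%type W
      (fun p => (to_wedge p.1, p.2))).
    * by rewrite -classical_sets.setXTT; apply: compact_setX; [exact: realization_compact|exact: unit_interval_compact].
    * apply: hausdorff_prod; first exact: wedge_of_spheres_hausdorff.
      by apply: hausdorff_set_type; exact: Rhausdorff.
    * apply: cont_pair; last exact: cont_snd.
      by apply: (cont_comp (@cont_fst _ _)); exact: to_wedge_continuous.
    * by move=> [y s]; have [x xy] := to_wedge_surj y; exists (x, s); rewrite /= xy.
    * rewrite (_ : _ \o _ = fun p => to_wedge (slide p.1 (flip p.2))).
        exact: cont_comp cslide to_wedge_continuous.
      by apply/funext => -[x s] /=; exact: rE.
  + by rewrite flip0.
  + by rewrite flip1 slide0 preimage_ptK.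
Qed.
End Main.

End WedgeTheorem.

(** * Checking a collapse of an order complex on labels *)

Section Check.

(** The vertices of the poset are labelled by the numbers below [n], and
    [nth [::] nbrs a] lists the labels other than [a] of the elements comparable
    with that of [a].  The nonfaces are the incomparable pairs together with an
    explicit list [cl]. *)
Variables (n : nat) (nbrs : seq (seq nat)).

Definition lab_adj a := nth [::] nbrs a.
Definition lab_cmp a b := if a == b then true else b \in lab_adj a.
Definition contains_nonface (cl : seq (seq nat)) s :=
  if has (fun a => has (fun b => ~~ lab_cmp a b) s) s then true
  else has (fun c => all (mem s) c) cl.
(** [link_coned] on labels.  For the incomparable pairs [v, w] only those [w] are
    tested that are equal or comparable to the first label of [s], as the others
    form an incomparable pair with it; and a nonface of [cl] contained in [w :: s]
    has at most one label outside [s]. *)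
Definition step_ok cl (s : seq nat) v :=
  [&& s != [::], v \notin s, all (fun b => b < n) (v :: s),
     let near := [seq c <- cl | size [seq b <- c | b \notin s] <= 1] in
     all (fun w => if lab_cmp v w then true else contains_nonface near (w :: s)) (head 0 s :: lab_adj (head 0 s))
   & all (fun c => if v \in c then contains_nonface cl (s ++ [seq b <- c | b != v]) else true) cl].

Fixpoint collapse_ok cl (st : seq (seq nat * nat)) :=
  if st is (s, v) :: st' then if step_ok cl s v then collapse_ok (s :: cl) st' else false else true.

(** The first line says that each critical cell is a facet of the order complex and
    is not the final vertex [v0]; the second that no critical cell contains
    another one. *)
Definition certificate_ok (v0 : nat) (crits : seq (seq nat)) (st : seq (seq nat * nat)) :=
 [&& all (fun c => [&& uniq c, all (fun b => b < n) c, all (fun a => all (lab_cmp a) c) c,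
       all (fun v => if v \in c then true else has (fun u => ~~ lab_cmp u v) c) (iota 0 n)
       & ~~ all (pred1 v0) c]) crits,
     all (fun c : seq nat => all (fun c' : seq nat => if c == c' then true else ~~ all (mem c') c) crits) crits,
     collapse_ok crits st
   & (v0 < n) && all (fun a => if a == v0 then true else [:: a] \in unzip1 st) (iota 0 n)].

Context {d : Order.disp_t} {P : finPOrderType d}.
Variable pt : nat -> P.
Hypothesis pt_surj : forall x, exists2 a, a < n & pt a = x.
Hypothesis pt_inj : forall a b, a < n -> b < n -> pt a = pt b -> a = b.
Hypothesis pt_cmp : forall a b, a < n -> b < n -> (pt a >=< pt b)%O = lab_cmp a b.

Definition antichains : {set {set P}} :=
  [set c : {set P} | [exists x, exists y, ~~ (x >=< y)%O && (c == [set x; y])]].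

Lemma antichain_pair x y : ~~ (x >=< y)%O -> [set x; y] \in antichains.
Proof.
by move=> xy; rewrite inE; apply/existsP; exists x; apply/existsP; exists y; rewrite xy eqxx.
Qed.

Lemma antichainP c : reflect (exists x y, ~~ (x >=< y)%O /\ c = [set x; y]) (c \in antichains).
Proof.
rewrite inE; apply: (iffP existsP) => [[x /existsP[y /andP[xy /eqP ->]]]|[x [y [xy ->]]]].
  by exists x, y.
by exists x; apply/existsP; exists y; rewrite xy eqxx.
Qed.

Lemma order_complex_faces : order_complex P = faces antichains.
Proof.
apply/setP => s; rewrite !inE; congr andb.
apply/forall_inP/forall_inP => [cmp_s c /antichainP[x [y [xy ->]]]|sN x xs].
  apply: contra xy => /subsetP sub.
  have xs : x \in s by rewrite sub // !inE eqxx.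
  have ys : y \in s by rewrite sub // !inE eqxx orbT.
  exact: (forall_inP (cmp_s x xs)).
apply/forall_inP => y ys; apply: contraT => xy.
have /negP[] := sN _ (antichain_pair xy).
by apply/subsetP => z; rewrite !inE => /orP[] /eqP->.
Qed.

Definition lab_set (s : seq nat) : {set P} := [set x | x \in map pt s].

Lemma lab_setP s x : reflect (exists2 a, a \in s & x = pt a) (x \in lab_set s).
Proof. by rewrite inE; exact: mapP. Qed.

Lemma mem_lab_set s a : all (fun b => b < n) s -> a < n -> (pt a \in lab_set s) = (a \in s).
Proof.
move=> /allP sn an; apply/lab_setP/idP => [[b bs /pt_inj ->]//|as_]; last by exists a.
exact: sn.
Qed.

Lemma lab_set_sub s s' : {subset s <= s'} -> lab_set s \subset lab_set s'.
Proof. by move=> ss; apply/subsetP => _ /lab_setP[a /ss as' ->]; apply/lab_setP; exists a. Qed.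

(** The complex at an intermediate stage of the collapse. *)
Definition nonfaces (cl : seq (seq nat)) : {set {set P}} :=
  antichains :|: [set c | c \in map lab_set cl].

Lemma nonfacesP cl c : reflect (c \in antichains \/ exists2 s, s \in cl & c = lab_set s) (c \in nonfaces cl).
Proof.
apply: (iffP setUP) => -[cN|cN]; try by left.
  by move: cN; rewrite inE => /mapP[s scl ->]; right; exists s.
by case: cN => s scl ->; right; rewrite inE; exact: map_f.
Qed.

Lemma contains_nonfaceP cl cl' s : {subset cl <= cl'} -> all (fun b => b < n) s ->
  contains_nonface cl s -> exists2 c, c \in nonfaces cl' & c \subset lab_set s.
Proof.
move=> sub /allP sn; rewrite /contains_nonface; case: ifP => [/hasP[a a_s /hasP[b bs ab]] _|_ /hasP[c ccl /allP cs]].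
  exists [set pt a; pt b].
    by apply/nonfacesP; left; apply: antichain_pair; rewrite pt_cmp ?sn.
  by apply/subsetP => x; rewrite !inE => /orP[] /eqP->; exact: map_f.
exists (lab_set c); last exact: lab_set_sub.
by apply/nonfacesP; right; exists c => //; exact: sub.
Qed.

Lemma step_link_coned cl s v : all (all (fun b => b < n)) cl -> step_ok cl s v ->
  link_coned (nonfaces cl) (lab_set s) (pt v).
Proof.
move=> /allP cln /and5P[s0 vs /andP[vn sn] + /allP far] c.
set a := head 0 s => /allP near.
have {}sn : all (fun b => b < n) s by [].
have a_s : a \in s by rewrite /a; case: (s) s0 => //= b s' _; exact: mem_head.
have an : a < n by exact: (allP sn).
case/nonfacesP => [/antichainP[x [y [xy ->]]]|[l lcl ->]]; last first.
  have ln := cln l lcl; rewrite mem_lab_set // => vl.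
  move: (far l lcl); rewrite vl; set l' := [seq b <- l | b != v] => bl.
  have l'n : all (fun b => b < n) (s ++ l').
    by rewrite all_cat sn /=; apply/allP => b; rewrite mem_filter => /andP[_ /(allP ln)].
  have [c' c'N c's] := contains_nonfaceP (fun _ => id) l'n bl.
  exists c' => //; apply: subset_trans c's _; apply/subsetP => _ /lab_setP[b + ->].
  rewrite mem_cat => /orP[bs|]; first by apply/setUP; right; apply/lab_setP; exists b.
  rewrite mem_filter => /andP[bv bl']; apply/setUP; left; apply/setD1P; split.
    by apply: contra_neq bv => /pt_inj; apply=> //; exact: (allP ln).
  by apply/lab_setP; exists b.
have key w : w < n -> ~~ lab_cmp v w ->
    exists2 c', c' \in nonfaces cl & c' \subset (pt w |: lab_set s).
  move=> wn vw.
  have sE : pt w |: lab_set s = lab_set (w :: s) by apply/setP => z; rewrite !inE.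
  have wsn : all (fun b => b < n) (w :: s) by rewrite /= wn.
  rewrite sE; have [|waN] := boolP (w \in a :: lab_adj a).
    move/near; rewrite (negPf vw); apply: contains_nonfaceP wsn => l.
    by rewrite mem_filter => /andP[].
  apply: (@contains_nonfaceP cl cl) => //; rewrite /contains_nonface ifT //.
  apply/hasP; exists a; first by rewrite inE a_s orbT.
  apply/hasP; exists w; first exact: mem_head.
  move: waN; rewrite inE negb_or /lab_cmp => /andP[wa wadj].
  by rewrite eq_sym (negPf wa).
have other w : ~~ (pt v >=< w)%O -> exists2 c', c' \in nonfaces cl & c' \subset (w |: lab_set s).
  by have [b bn <-] := pt_surj w; rewrite pt_cmp // => /key; apply.
have vne w : ~~ (pt v >=< w)%O -> w != pt v.
  by apply: contraNneq => ->; exact: comparablexx.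
rewrite !inE => /orP[] /eqP vE; subst.
- have [c' c'N c's] := other _ xy; exists c' => //; apply: subset_trans c's _.
  by apply: setSU; rewrite sub1set !inE eqxx orbT andbT; exact: vne.
- rewrite comparable_sym in xy.
  have [c' c'N c's] := other _ xy; exists c' => //; apply: subset_trans c's _.
  by apply: setSU; rewrite sub1set !inE eqxx andbT; exact: vne.
Qed.

Lemma collapse_ok_collapses cl st : all (all (fun b => b < n)) cl -> collapse_ok cl st ->
  collapses (nonfaces cl) [seq (lab_set x.1, pt x.2) | x <- st].
Proof.
elim: st cl => //= -[s v] st IH cl cln; case: ifP => // ok rn.
have cf := step_link_coned cln ok.
have /and5P[s0 vs /andP[vn sn] _ _] := ok.
have {}sn : all (fun b => b < n) s by [].
split=> //.
- case: (s) s0 => // a s' _; apply/set0Pn; exists (pt a); apply/lab_setP; exists a => //.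
  exact: mem_head.
- by rewrite mem_lab_set.
- rewrite (_ : _ |: _ = nonfaces (s :: cl)).
    by apply: IH rn; rewrite /= sn cln.
  apply/setP => c; rewrite !inE.
  by rewrite orbCA.
Qed.

Section Wedge.
Context (R : realType) (I : finType) (dim : I -> nat) (crl : I -> seq nat).
Variables (i0 : I) (v0 : nat) (crits : seq (seq nat)) (st : seq (seq nat * nat)).
Hypothesis crl_size : forall i, size (crl i) = (dim i).+1.
Hypothesis crl_inj : injective crl.
Hypothesis crl_codom : forall c, reflect (exists i, c = crl i) (c \in crits).
Hypothesis ok : certificate_ok v0 crits st.

Let vert i (j : 'I_(dim i).+1) := pt (nth 0 (crl i) j).

Theorem certified_wedge :
  homotopy_equivalent R (realization R (order_complex P)) (sphere_wedge R dim).
Proof.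
have /and4P[/allP crits_ok /allP crits_dist rn /andP[v0n /allP st_all]] := ok.
have critin i : crl i \in crits by apply/crl_codom; exists i.
have facetE i : facet vert i = lab_set (crl i).
  apply/setP => x; apply/imsetP/lab_setP => [[j _ ->]|[a ain ->]].
    by exists (nth 0 (crl i) j) => //; apply: mem_nth; rewrite crl_size.
  have ltj : index a (crl i) < (dim i).+1 by rewrite -crl_size index_mem.
  by exists (Ordinal ltj); rewrite // /vert /= nth_index.
have crn i : all (fun b => b < n) (crl i) by have /and5P[] := crits_ok _ (critin i).
have puncturedE : punctured antichains vert = nonfaces crits.
  congr (_ :|: _); apply/setP => c; rewrite !inE; apply/imsetP/mapP => [[i _ ->]|[s /crl_codom[i ->] ->]].
    by exists (crl i); rewrite // facetE.
  by exists i; rewrite // facetE.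
rewrite order_complex_faces; apply: (@realization_wedge R P antichains I dim vert i0
  [seq (lab_set x.1, pt x.2) | x <- st] (pt v0)).
- move=> i j k; rewrite /vert => E.
  have /and5P[cu _ _ _ _] := crits_ok _ (critin i).
  have lt (l : 'I_(dim i).+1) : nth 0 (crl i) l < n by apply: (allP (crn i)); rewrite mem_nth ?crl_size.
  by have /eqP := pt_inj (lt j) (lt k) E; rewrite nth_uniq ?crl_size // => /eqP /val_inj.
- move=> i j E; apply: crl_inj; apply/eqP; apply: contraT => ij.
  have /allP/(_ _ (critin j)) := crits_dist _ (critin i); rewrite (negPf ij) => /negP[].
  apply/allP => a ai; rewrite /= -(mem_lab_set (crn j)) ?(allP (crn i)) // -facetE -E facetE.
  by rewrite mem_lab_set ?(allP (crn i)).
- move=> i c /antichainP[x [y [xy ->]]]; apply: contra xy => /subsetP sub.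
  have := sub x; rewrite !inE eqxx => /(_ isT); rewrite facetE => /lab_setP[a ai ->].
  have := sub y; rewrite !inE eqxx orbT => /(_ isT); rewrite facetE => /lab_setP[b bi ->].
  have /and5P[_ _ /allP/(_ a ai)/allP/(_ b bi) ab _ _] := crits_ok _ (critin i).
  by rewrite pt_cmp ?(allP (crn i)).
- move=> i x; have [v vn <-] := pt_surj x; rewrite facetE mem_lab_set // => vi.
  have /and5P[_ _ _ /allP/(_ v) + _] := crits_ok _ (critin i).
  rewrite mem_iota vn (negPf vi) => /(_ isT)/hasP[u ui uv].
  exists [set pt u; pt v]; first by apply: antichain_pair; rewrite pt_cmp ?(allP (crn i) u ui).
  apply/subsetP => z; rewrite !inE => /orP[] /eqP ->; last by rewrite eqxx.
  by rewrite map_f ?orbT.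
- rewrite puncturedE; apply: collapse_ok_collapses => //; apply/allP => c /crl_codom[i ->]; exact: crn.
- move=> x; have [a an <-] := pt_surj x => av.
  have := st_all a; rewrite mem_iota an ifN => [/(_ isT)|]; last by apply: contraNneq av => ->.
  case/mapP=> -[s v] sin /= E; rewrite -map_comp; apply/mapP; exists (s, v) => //=.
  by rewrite -E; apply/setP => z; rewrite !inE.
- move=> c; rewrite puncturedE => /nonfacesP[/antichainP[x [y [xy ->]]]|[s /crl_codom[i ->] ->]].
    apply: contra xy => /subsetP sub.
    have := sub x; rewrite !inE eqxx => /(_ isT)/eqP->.
    have := sub y; rewrite !inE eqxx orbT => /(_ isT)/eqP->.
    exact: comparablexx.
  have /and5P[_ _ _ _] := crits_ok _ (critin i); apply: contra => /subsetP sub.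
  apply/allP => a ai /=; apply/eqP; apply: pt_inj => //; first exact: (allP (crn i)).
  have aimg : pt a \in lab_set (crl i) by apply/lab_setP; exists a.
  by have := sub _ aimg; rewrite inE => /eqP.
Qed.

End Wedge.
End Check.

(** * The subgroups of a group given by its multiplication table *)

Section Masks.

(** The group has [n] elements, numbered from 0, and its identity is the element
    [e]; [T] is the multiplication table, row by row.  A subset of the group is a
    bit mask of length [n]. *)
Variables (n : nat) (e : nat) (T : seq (seq nat)).

Definition tmul i j := nth 0 (nth [::] T i) j.
Definition tinv i := index e (nth [::] T i).

Definition set_bit (b : bitseq) i := set_nth false b i true.
Definition of_list (s : seq nat) : bitseq := foldl set_bit (nseq n false) s.
Definition to_list (b : bitseq) := [seq i <- iota 0 n | nth false b i].

(** Breadth-first search in the Cayley graph: [queue] holds the elements found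
    whose products with the generators are still to be formed.  Each element
    enters the queue once, so that [n] rounds are enough. *)
Fixpoint grow fuel (gens queue : seq nat) (b : bitseq) : bitseq :=
  match fuel, queue with
  | k.+1, i :: q =>
    let row := nth [::] T i in
    let news := undup [seq j <- [seq nth 0 row g | g <- gens] | ~~ nth false b j] in
    grow k gens (news ++ q) (foldl set_bit b news)
  | _, _ => b
  end.
Definition gen_mask gens := grow n gens [:: e] (of_list [:: e]).
Definition conj_mask (s : seq nat) x : bitseq :=
  let x' := tinv x in of_list [seq tmul (tmul x' i) x | i <- s].
Definition conj_masks b := let s := to_list b in undup [seq conj_mask s x | x <- iota 0 n].
Definition submask (b c : bitseq) := all2 implb b c.

Definition closed_mask b := let s := to_list b in
  nth false b e && all (fun i => all (fun j => nth false b (tmul i j)) s) s.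

(** A subgroup that contains [s] and [h] contains the coset of [h], and thus its
    least element: only the least elements of the cosets have to be adjoined. *)
Definition least_in_coset (s : seq nat) g := all (fun i => g <= tmul i g) s.
(** Adjoining any element to the subgroup generated by [gens] yields a subgroup
    with a mask in [subs], or the whole group. *)
Definition extensions_listed (subs : seq bitseq) gens :=
  let b := gen_mask gens in let s := to_list b in
  all (fun g => if nth false b g then true else if least_in_coset s g then
     let m := gen_mask (g :: gens) in
     [&& submask b m, nth false m g & (m == nseq n true) || (m \in subs)] else true) (iota 0 n).

Definition listed (gens : seq (seq nat)) := flatten [seq conj_masks (gen_mask g) | g <- gens].
Definition inverses_ok := all (fun i => (tinv i < n) && (tmul i (tinv i) == e)) (iota 0 n).
(** The trivial subgroup comes first, as the starting point of the search for
    subgroups. *)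
Definition classified (gens : seq (seq nat)) :=
  let subs := listed gens in
  [&& inverses_ok, all (all (fun i => i < n)) gens, gens != [::],
      head [::] gens == [::], all (fun g => let b := gen_mask g in closed_mask b && all (nth false b) g) gens
    & all (extensions_listed subs) gens].

Lemma nth_foldl_set_bit s b j : nth false (foldl set_bit b s) j = (j \in s) || nth false b j.
Proof.
elim: s b => //= i s IH b; rewrite IH nth_set_nth /= inE.
by case: (j == i); rewrite ?orbT.
Qed.

Lemma nth_of_list s j : nth false (of_list s) j = (j \in s).
Proof. by rewrite nth_foldl_set_bit nth_nseq if_same orbF. Qed.

Lemma size_of_list s : all (fun i => i < n) s -> size (of_list s) = n.
Proof.
rewrite /of_list; have: size (nseq n false) = n by rewrite size_nseq.
elim: s (nseq n false) => //= i s IH b sb /andP[i_n sn].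
by apply: IH => //; rewrite size_set_nth sb; apply/maxn_idPr.
Qed.

Lemma mem_to_list b i : (i \in to_list b) = (i < n) && nth false b i.
Proof. by rewrite mem_filter mem_iota andbC. Qed.

Lemma submaskP b c : size b = size c ->
  reflect (forall i, nth false b i -> nth false c i) (submask b c).
Proof.
rewrite /submask; elim: b c => [|x b IH] [|y c] //= sz.
  by apply: ReflectT => i; rewrite nth_nil.
apply: (iffP andP) => [[xy /IH h] [|i] //=|h].
  - by move=> hx; rewrite hx in xy.
  - by apply: h; case: sz.
split; first by have := h 0 => /=; case: (x) => // ->.
by apply/IH => [|i]; [case: sz|exact: h i.+1].
Qed.

Lemma submask_nth b c i : submask b c -> nth false b i -> nth false c i.
Proof.
rewrite /submask; elim: b c i => [|x b IH] [|y c] [|i] //= /andP[xy bc] //; last exact: IH.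
by move=> hx; rewrite hx in xy.
Qed.

Section Model.
Variables (gT : finGroupType) (G : {group gT}) (elt : nat -> gT).
Local Open Scope group_scope.
Hypothesis elt_in : forall i, i < n -> elt i \in G.
Hypothesis elt_surj : forall g, g \in G -> exists2 i, i < n & elt i = g.
Hypothesis elt_inj : forall i j, i < n -> j < n -> elt i = elt j -> i = j.
Hypothesis tmul_lt : forall i j, i < n -> j < n -> tmul i j < n.
Hypothesis eltM : forall i j, i < n -> j < n -> elt (tmul i j) = elt i * elt j.
Hypotheses (e_lt : e < n) (elt1 : elt e = 1).

Definition carrier (b : bitseq) : {set gT} := [set elt i | i : 'I_n & nth false b i].

Lemma carrierP b g :
  reflect (exists i, [/\ i < n, nth false b i & g = elt i]) (g \in carrier b).
Proof.
apply: (iffP imsetP) => [[i]|[i [i_n bi ->]]].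
  by rewrite inE => bi ->; exists i.
by exists (Ordinal i_n) => //; rewrite inE.
Qed.

Lemma mem_carrier b i : i < n -> (elt i \in carrier b) = nth false b i.
Proof.
move=> i_n; apply/carrierP/idP => [[j [j_n bj /elt_inj ->]]//|bi].
by exists i.
Qed.

Lemma carrier_sub b c : size b = n -> size c = n -> (carrier b \subset carrier c) = submask b c.
Proof.
move=> sb sc; apply/subsetP/submaskP => [|bc i bi|bc g /carrierP[i [i_n bi ->]]].
- by rewrite sb sc.
- have i_n : i < n by rewrite -sb ltnNge; apply: contraTN bi => /(nth_default false)->.
  by rewrite -mem_carrier // bc // mem_carrier.
- by rewrite mem_carrier // bc.
Qed.

Lemma carrier_full b : b = nseq n true -> carrier b = G.
Proof.
move=> ->; apply/setP => g; apply/carrierP/idP => [[i [i_n _ ->]]|/elt_surj[i i_n <-]].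
  exact: elt_in.
by exists i; rewrite nth_nseq i_n.
Qed.

Lemma gen_mask_sub gens (H : {group gT}) :
  (forall g, g \in gens -> g < n /\ elt g \in H) -> carrier (gen_mask gens) \subset H.
Proof.
move=> gH; apply/subsetP => _ /carrierP[i [i_n + ->]].
suff: forall j, nth false (gen_mask gens) j -> j < n /\ elt j \in H by move=> h /h[].
pose sound j := j < n /\ elt j \in H.
suff gen fuel q b : (forall j, j \in q -> sound j) -> (forall j, nth false b j -> sound j) ->
    forall j, nth false (grow fuel gens q b) j -> sound j.
  by apply: gen => j; rewrite ?nth_of_list inE => /eqP->; rewrite /sound elt1.
clear i i_n; elim: fuel q b => [|k IH] [|i q] b qH bH; try exact: bH.
have [i_n iH] : i < n /\ elt i \in H by apply: qH; rewrite mem_head.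
have newsH j : j \in undup [seq j <- [seq nth 0 (nth [::] T i) g | g <- gens] | ~~ nth false b j] ->
    sound j.
  rewrite mem_undup mem_filter => /andP[_ /mapP[g /gH[g_n gH'] ->]].
  by rewrite /sound -/(tmul i g) eltM ?tmul_lt ?groupM.
apply: IH => j /=; first by rewrite mem_cat => /orP[/newsH|jq] //; apply: qH; rewrite inE jq orbT.
by rewrite nth_foldl_set_bit => /orP[/newsH|/bH].
Qed.

Hypothesis inv_ok : inverses_ok.

Lemma tinv_lt i : i < n -> tinv i < n.
Proof. by move=> i_n; have /allP/(_ i) := inv_ok; rewrite mem_iota i_n => /(_ isT)/andP[]. Qed.

Lemma eltV i : i < n -> elt (tinv i) = (elt i)^-1.
Proof.
move=> i_n; have /allP/(_ i) := inv_ok; rewrite mem_iota i_n => /(_ isT)/andP[inv_n /eqP E].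
by apply/eqP; rewrite eq_sym eq_invg_mul -eltM // E elt1.
Qed.

Lemma conj_mask_lt b x : x < n -> all (fun i => i < n) [seq tmul (tmul (tinv x) i) x | i <- to_list b].
Proof.
move=> x_n; apply/allP => _ /mapP[i i_in ->]; move: i_in; rewrite mem_to_list => /andP[i_n _].
by rewrite !tmul_lt ?tinv_lt.
Qed.

Lemma size_conj_mask b x : x < n -> size (conj_mask (to_list b) x) = n.
Proof. by move=> x_n; apply: size_of_list; exact: conj_mask_lt. Qed.

Lemma carrier_conj_mask b x : x < n -> carrier (conj_mask (to_list b) x) = carrier b :^ elt x.
Proof.
move=> x_n; apply/setP => g; rewrite mem_conjg.
have cE i : i < n -> elt (tmul (tmul (tinv x) i) x) = elt i ^ elt x.
  by move=> i_n; rewrite !eltM ?tmul_lt ?tinv_lt // eltV // conjgE mulgA.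
apply/carrierP/carrierP => [[k [_ k_in ->]]|[i [i_n bi gi]]].
  move: k_in; rewrite nth_of_list => /mapP[i i_in ->].
  move: i_in; rewrite mem_to_list => /andP[i_n bi].
  by exists i; split=> //; rewrite cE // conjgK.
exists (tmul (tmul (tinv x) i) x); split; first by rewrite !tmul_lt ?tinv_lt.
  by rewrite nth_of_list; apply: map_f; rewrite mem_to_list i_n.
by rewrite cE // -gi conjgKV.
Qed.

Lemma closed_mask_group b : closed_mask b -> group_set (carrier b).
Proof.
case/andP=> be /allP bM; apply/group_setP; split.
  by rewrite -elt1 mem_carrier.
move=> _ _ /carrierP[i [i_n bi ->]] /carrierP[j [j_n bj ->]].
rewrite -eltM // mem_carrier ?tmul_lt //.
have /bM/allP/(_ j) : i \in to_list b by rewrite mem_to_list i_n.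
by rewrite mem_to_list j_n; apply.
Qed.

Variable gens : seq (seq nat).
Hypothesis gens_ok : classified gens.
Let subs := listed gens.

Lemma listedP b : reflect (exists g x, [/\ g \in gens, x < n & b = conj_mask (to_list (gen_mask g)) x]) (b \in subs).
Proof.
apply: (iffP flatten_mapP) => [[g gg]|[g [x [gg x_n ->]]]].
  by rewrite mem_undup => /mapP[x]; rewrite mem_iota => x_n ->; exists g, x.
by exists g => //; rewrite mem_undup; apply: map_f; rewrite mem_iota.
Qed.

Lemma listed_size b : b \in subs -> size b = n.
Proof. by case/listedP=> g [x [_ x_n ->]]; exact: size_conj_mask. Qed.

Lemma rep_closed g : g \in gens -> group_set (carrier (gen_mask g)).
Proof.
have /and5P[_ _ _ _ /andP[/allP cl _]] := gens_ok.
by move=> /cl /andP[/closed_mask_group].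
Qed.

Lemma rep_contains g i : g \in gens -> i \in g -> nth false (gen_mask g) i.
Proof.
have /and5P[_ _ _ _ /andP[/allP cl _]] := gens_ok.
by move=> /cl /andP[_ /allP]; apply.
Qed.

Lemma listed_group b : b \in subs -> group_set (carrier b).
Proof.
case/listedP=> g [x [gg x_n ->]]; rewrite carrier_conj_mask //.
by have := groupP (conjG_group (Group (rep_closed gg)) (elt x)).
Qed.

Lemma listed_conj b x : b \in subs -> x < n -> exists2 c, c \in subs & carrier c = carrier b :^ elt x.
Proof.
case/listedP=> g [y [gg y_n ->]] x_n; exists (conj_mask (to_list (gen_mask g)) (tmul y x)).
  by apply/listedP; exists g, (tmul y x); split=> //; exact: tmul_lt.
by rewrite !carrier_conj_mask ?tmul_lt // eltM // conjsgM.
Qed.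

Lemma rep_listed g : g \in gens -> exists2 b, b \in subs & carrier b = carrier (gen_mask g).
Proof.
move=> gg; exists (conj_mask (to_list (gen_mask g)) e); first by apply/listedP; exists g, e.
by rewrite carrier_conj_mask // elt1 conjsg1.
Qed.

(** Choose [h] in [H] outside the representative [r], and replace it by the least
    element of its coset; the check then exhibits a listed subgroup of [H] that is
    larger than [r]. *)
Lemma rep_extends g (H : {group gT}) : g \in gens -> H \subset G ->
  carrier (gen_mask g) \proper H ->
  H = G \/ exists2 b, b \in subs & carrier (gen_mask g) \proper carrier b /\ carrier b \subset H.
Proof.
move=> gg HG /properP[rH [h hH hr]].
have /and5P[_ gens_lt _ _ /andP[_ /allP/(_ g gg)]] := gens_ok.
rewrite /extensions_listed; set r := gen_mask g => /allP ext.
have grp : group_set (carrier r) by exact: rep_closed.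
have [j j_n hj] := elt_surj (subsetP HG _ hH); subst h.
pose coset k := [exists i : 'I_n, nth false r i && (k == tmul i j)].
have exk : exists k, coset k.
  have re : nth false r e by rewrite -mem_carrier // elt1; case/group_setP: grp.
  by exists (tmul e j); apply/existsP; exists (Ordinal e_lt); rewrite /= re eqxx.
have [k /existsP[i /andP[ri /eqP kE]] kmin] := ex_minnP exk.
have k_n : k < n by rewrite kE tmul_lt.
have iH : elt i \in H by apply: (subsetP rH); rewrite mem_carrier.
have kH : elt k \in H by rewrite kE eltM // groupM.
have kr : ~~ nth false r k.
  rewrite -mem_carrier // kE eltM //.
  by rewrite (@groupMl _ (Group grp)) //= mem_carrier.
move: (ext k); rewrite mem_iota k_n (negPf kr) => /(_ isT).
have -> : least_in_coset (to_list r) k.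
  apply/allP => i'; rewrite mem_to_list => /andP[i'_n ri']; apply: kmin.
  have : elt i' * elt i \in carrier r.
    by rewrite (@groupM _ (Group grp)) //= mem_carrier.
  rewrite -eltM // mem_carrier ?tmul_lt // => rii.
  apply/existsP; exists (Ordinal (tmul_lt i'_n (ltn_ord i))) => /=; rewrite rii.
  by apply/eqP/elt_inj; rewrite ?tmul_lt // kE !eltM ?tmul_lt // mulgA.
case/and3P=> rm mk msub.
have mH : carrier (gen_mask (k :: g)) \subset H.
  apply: gen_mask_sub => i'; rewrite inE => /predU1P[->//|i'g].
  have i'_n : i' < n by move/allP/(_ g gg)/allP: gens_lt => /(_ _ i'g).
  split=> //; apply: (subsetP rH); rewrite mem_carrier //.
  exact: rep_contains.
have rb : carrier r \proper carrier (gen_mask (k :: g)).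
  apply/properP; split; last by exists (elt k); rewrite mem_carrier.
  by apply/subsetP => _ /carrierP[i' [i'_n ri' ->]]; rewrite mem_carrier // (submask_nth rm).
case/orP: msub => [/eqP/carrier_full E|msub]; [left|by right; exists (gen_mask (k :: g))].
by apply/group_inj/eqP; rewrite eqEsubset HG -E.
Qed.

(** Take a listed subgroup of [H] of the largest order.  It is a conjugate of a
    representative; if it were smaller than [H], then [rep_extends], applied after
    conjugating back, would give a larger listed subgroup of [H], or [H] would be
    the whole group. *)
Lemma classification (H : {group gT}) : H \subset G ->
  H = G \/ exists2 b, b \in subs & H = carrier b :> {set gT}.
Proof.
move=> HG; pose P k := [exists b : seq_sub subs, (carrier (val b) \subset H) && (#|carrier (val b)| == k)].
have /and5P[_ _ g0 hg _] := gens_ok.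
have exP : exists k, P k.
  have nilg : [::] \in gens by rewrite -(eqP hg); case: (gens) g0 => //= a l _; rewrite mem_head.
  have [b bsubs bE] := rep_listed nilg.
  exists #|carrier b|; apply/existsP; exists (SeqSub bsubs); rewrite /= eqxx andbT bE.
  exact: gen_mask_sub.
have Pmax k : P k -> k <= #|H|.
  by case/existsP=> b /andP[bH /eqP <-]; exact: subset_leq_card.
have [k /existsP[[b bsubs] /= /andP[bH /eqP bk]] kmax] := ex_maxnP exP Pmax.
have [EH|nEH] := eqVneq (carrier b) H; first by right; exists b.
have /listedP[g [x [gg x_n bE]]] := bsubs.
have bgE : carrier b = carrier (gen_mask g) :^ elt x by rewrite bE carrier_conj_mask.
have xG : elt x \in G by exact: elt_in.
have [|||[c csubs [gc cH]]] := @rep_extends g (H :^ (elt x)^-1)%G gg.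
- by rewrite sub_conjgV (normsP (normG G)).
- rewrite properEneq; apply/andP; split; last by rewrite -sub_conjg -bgE.
  apply: contraNneq nEH => E; rewrite bgE E /=.
  by rewrite conjsgKV.
- move=> E; left; apply/group_inj => /=.
  have /= := congr1 (fun K : {group gT} => K :^ elt x) E.
  by rewrite conjsgKV (normsP (normG G)).
have [d dsubs dE] := listed_conj csubs x_n.
have : #|carrier d| <= k.
  apply: kmax; apply/existsP; exists (SeqSub dsubs); rewrite /= eqxx andbT dE.
  by rewrite sub_conjg.
rewrite -bk bgE dE !cardJg leqNgt => /negP[]; exact: proper_card.
Qed.

End Model.
End Masks.

(** * The multiplication table of PSL(2,7) *)

Section ProjectiveSpecialLinear.

Definition mat22 := (nat * nat * (nat * nat))%type.
Definition det7 (x : mat22) := let: (a, b, (c, d)) := x in (a * d + 6 * (b * c)) %% 7.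
Definition opp7 (x : mat22) : mat22 :=
  let: (a, b, (c, d)) := x in ((6 * a) %% 7, (6 * b) %% 7, ((6 * c) %% 7, (6 * d) %% 7)).
Definition mul7 (x y : mat22) : mat22 :=
  let: (a, b, (c, d)) := x in let: (e, f, (g, h)) := y in
  ((a * e + b * g) %% 7, (a * f + b * h) %% 7,
   ((c * e + d * g) %% 7, (c * f + d * h) %% 7)).
(** Of a matrix and its opposite, the representative is the one whose first nonzero
    entry is 1, 2 or 3; the first row of an invertible matrix is not zero. *)
Definition sign_normal (x : mat22) := let: (a, b, _) := x in
  if a is 0 then b < 4 else a < 4.
Definition sign_norm (x : mat22) := if sign_normal x then x else opp7 x.
Definition one7 : mat22 := (1, 0, (0, 1)).
Definition all_mat : seq mat22 :=
  let r := iota 0 7 in let r2 := [seq (a, b) | a <- r, b <- r] in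
  [seq (u, v) | u <- r2, v <- r2].
Definition psl_mats : seq mat22 := [seq x <- all_mat | (det7 x == 1) && sign_normal x].
Definition psl_table : seq (seq nat) :=
  [seq [seq index (sign_norm (mul7 x y)) psl_mats | y <- psl_mats] | x <- psl_mats].

Lemma cosetM (gT : finGroupType) (K : {group gT}) (x y : gT) : (x \in 'N(K) -> y \in 'N(K) ->
  coset K (x * y) = coset K x * coset K y)%g.
Proof. by move=> xN yN; rewrite morphM. Qed.

Lemma coset_eq (gT : finGroupType) (K : {group gT}) (x y : gT) : (x \in 'N(K) -> y \in 'N(K) ->
  coset K x = coset K y -> x * y^-1 \in K)%g.
Proof.
move=> xN yN E; apply: coset_idr; first by rewrite groupM ?groupV.
by rewrite cosetM ?groupV // morphV //= E mulgV.
Qed.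

Lemma coset_one (gT : finGroupType) (K : {group gT}) : coset K 1%g = 1%g.
Proof. exact: morph1. Qed.

Lemma divg_mem (gT : finGroupType) (K : {group gT}) (x y : gT) :
  (x \in K -> y \in K -> x * y^-1 \in K)%g.
Proof. by move=> xK yK; rewrite groupM ?groupV. Qed.

Lemma divg_eqP (gT : finGroupType) (x y z : gT) : (x * y^-1 = z -> x = z * y)%g.
Proof. by move=> <-; rewrite mulgKV. Qed.

Local Open Scope ring_scope.

Lemma det_mx22 (R : comPzRingType) (A : 'M[R]_2) : \det A = A 0 0 * A 1 1 - A 0 1 * A 1 0.
Proof.
rewrite (expand_det_row _ 0) !big_ord_recl big_ord0 addr0 /cofactor !det_mx11 !mxE /=.
rewrite expr0 expr1 mul1r mulN1r mulrN.
by congr (_ * A _ _ - A _ _ * A _ _); apply/val_inj.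
Qed.

Definition toM (x : mat22) : 'M['F_7]_2 := let: (a, b, (c, d)) := x in
  \matrix_(i, j) (if i == 0 then if j == 0 then a else b else if j == 0 then c else d)%:R.

Lemma natF7 k : (k %% 7)%:R = k%:R :> 'F_7.
Proof. exact: (@Fp_nat_mod 7). Qed.

Lemma det_toM x : \det (toM x) = (det7 x)%:R.
Proof.
case: x => [[a b] [c d]]; rewrite det_mx22 !mxE /= natF7 natrD !natrM.
have -> : 6%:R = -1 :> 'F_7 by apply/val_inj.
by rewrite mulN1r.
Qed.

Lemma toM_mul x y : toM (mul7 x y) = toM x *m toM y.
Proof.
case: x y => [[a b] [c d]] [[e f] [g h]]; apply/matrixP => i j.
rewrite !mxE !big_ord_recl big_ord0 addr0 !mxE /=.
by case: i j => [[|[]]] //= ? [[|[]]] //= ?; rewrite natF7 natrD !natrM.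
Qed.

Lemma toM_opp x : toM (opp7 x) = - toM x.
Proof.
case: x => [[a b] [c d]]; apply/matrixP => i j; rewrite !mxE.
have m1 k : ((6 * k) %% 7)%:R = - k%:R :> 'F_7.
  by rewrite natF7 natrM (_ : 6%:R = -1) ?mulN1r //; apply/val_inj.
by case: (i == 0); case: (j == 0); exact: m1.
Qed.

Lemma mem_all_mat a b c d :
  ((a, b, (c, d)) \in all_mat) = [&& a < 7, b < 7, c < 7 & d < 7]%N.
Proof.
have mr k : (k \in iota 0 7) = (k < 7)%N by rewrite mem_iota.
rewrite /all_mat; move: (iota 0 7) mr => r mr.
have mr2 i j : ((i, j) \in [seq (a, b) | a <- r, b <- r]) = (i < 7)%N && (j < 7)%N.
  apply/allpairsP/andP => [[[i' j'] /= [ii jj [-> ->]]]|[i7 j7]]; first by rewrite -!mr.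
  by exists (i, j); rewrite /= !mr.
apply/allpairsP/and4P => [[[u v] /= [uin vin E]]|[a7 b7 c7 d7]].
  move: uin vin; case: E => <- <-.
  by rewrite !mr2 => /andP[-> ->] /andP[-> ->].
by exists ((a, b), (c, d)); rewrite /= !mr2 a7 b7 c7 d7.
Qed.

Lemma natF7_inj i j : (i < 7)%N -> (j < 7)%N -> i%:R = j%:R :> 'F_7 -> i = j.
Proof.
move=> i7 j7 /(congr1 (fun k : 'F_7 => k : nat)).
by rewrite !(@val_Fp_nat 7) // !modn_small.
Qed.

Lemma toM_inj : {in all_mat &, injective toM}.
Proof.
move=> [[a b] [c d]] [[a' b'] [c' d']]; rewrite !mem_all_mat.
move=> /and4P[a7 b7 c7 d7] /and4P[a7' b7' c7' d7'] /matrixP E.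
have := E 0 0; have := E 0 1; have := E 1 0; have := E 1 1; rewrite !mxE /=.
by do 4!(move=> /natF7_inj -> //).
Qed.

Lemma toM_surj A : exists2 x, x \in all_mat & toM x = A.
Proof.
have lt7 (k : 'F_7) : (k < 7)%N by exact: (ltn_ord k).
exists (A 0 0 : nat, A 0 1 : nat, (A 1 0 : nat, A 1 1 : nat)).
  by rewrite mem_all_mat !lt7.
by apply/matrixP => i j; rewrite !mxE; case: i j => [[|[]]] //= ? [[|[]]] //= ?;
  rewrite natr_Zp; congr (A _ _); apply/val_inj.
Qed.

Definition toGL x : {'GL_2['F_7]} := @insubd _ _ {'GL_2['F_7]} 1%g (toM x).

Lemma GLval_toGL x : det7 x = 1%N -> GLval (toGL x) = toM x.
Proof.
move=> dx; rewrite /toGL; apply: (@insubdK _ _ {'GL_2['F_7]}).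
by rewrite unfold_in -/(_ \in unitmx) unitmxE det_toM dx unitr1.
Qed.

Lemma GL_inj (u v : {'GL_2['F_7]}) : GLval u = GLval v -> u = v.
Proof. exact: val_inj. Qed.

Lemma det7_lt x : (det7 x < 7)%N.
Proof. by case: x => [[a b] [c d]]; rewrite ltn_mod. Qed.

Lemma det7_eq1 x : (\det (toM x) == 1) = (det7 x == 1%N).
Proof.
rewrite det_toM; apply/eqP/eqP => [E|->//].
by apply: natF7_inj => //; exact: det7_lt.
Qed.

Lemma det7_mul x y : det7 x = 1%N -> det7 y = 1%N -> det7 (mul7 x y) = 1%N.
Proof.
by move=> dx dy; apply/eqP; rewrite -det7_eq1 toM_mul det_mulmx !det_toM dx dy mulr1.
Qed.

Lemma toGL_mul x y : det7 x = 1%N -> det7 y = 1%N -> toGL (mul7 x y) = (toGL x * toGL y)%g.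
Proof.
move=> dx dy; apply: GL_inj; rewrite GL_ME !GLval_toGL ?det7_mul //.
exact: toM_mul.
Qed.

Lemma toGL_SL x : det7 x = 1%N -> toGL x \in SL 2 'F_7.
Proof. by move=> dx; rewrite inE GLval_toGL // det_toM dx. Qed.

Lemma SL_toGL u : u \in SL 2 'F_7 -> exists2 x, x \in all_mat & det7 x = 1%N /\ toGL x = u.
Proof.
rewrite inE => du; have [x xin xu] := toM_surj (GLval u).
have dx : det7 x = 1%N by apply/eqP; rewrite -det7_eq1 xu.
by exists x => //; split=> //; apply: GL_inj; rewrite GLval_toGL.
Qed.

Local Notation Z := 'Z(SL_group 2 'F_7)%g.

Definition minus1 : mat22 := (6, 0, (0, 6))%N.

Lemma toM_one : toM one7 = 1%:M.
Proof.
by apply/matrixP => i j; rewrite !mxE; case: i j => [[|[]]] //= ? [[|[]]] //= ?; exact/val_inj.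
Qed.

Lemma toM_minus1 : toM minus1 = - 1%:M.
Proof.
by apply/matrixP => i j; rewrite !mxE; case: i j => [[|[]]] //= ? [[|[]]] //= ?; exact/val_inj.
Qed.

Lemma det7_opp x : det7 x = 1%N -> det7 (opp7 x) = 1%N.
Proof.
move=> dx; apply/eqP; rewrite -det7_eq1 toM_opp -scaleN1r detZ det_toM dx mulr1.
by rewrite -signr_odd.
Qed.

Lemma toGL_opp x : det7 x = 1%N -> toGL (opp7 x) = (toGL minus1 * toGL x)%g.
Proof.
move=> dx; apply: GL_inj; rewrite GL_ME !GLval_toGL ?det7_opp // toM_opp toM_minus1.
by rewrite -[RHS]/(- 1%:M *m toM x) mulNmx mul1mx.
Qed.

Lemma minus1_center : toGL minus1 \in Z.
Proof.
apply/centerP; split=> [|u uSL]; first exact: toGL_SL.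
have [x _ [dx <-]] := SL_toGL uSL.
rewrite /commute -toGL_opp //; apply: GL_inj.
rewrite GL_ME !GLval_toGL ?det7_opp // toM_opp toM_minus1.
by rewrite -[RHS]/(toM x *m - 1%:M) mulmxN mulmx1.
Qed.

Lemma mul7_mat x y : mul7 x y \in all_mat.
Proof. by case: x y => [[? ?] [? ?]] [[? ?] [? ?]]; rewrite mem_all_mat !ltn_mod. Qed.

Lemma opp7_mat x : opp7 x \in all_mat.
Proof. by case: x => [[? ?] [? ?]]; rewrite mem_all_mat !ltn_mod. Qed.

Definition shear : mat22 := (1, 1, (0, 1))%N.
Definition shear' : mat22 := (1, 0, (1, 1))%N.

(** The facts about matrices modulo 7 that are left to computation: the
    representatives up to sign are complete and irredundant, the matrices of
    determinant 1 that commute with both shears are the identity and its opposite,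
    and the table is closed. *)
Definition psl_model_ok :=
  [&& all (fun x => if det7 x == 1%N then sign_norm x \in psl_mats else true) all_mat,
      all (fun x => if det7 x == 1%N then if mul7 x shear == mul7 shear x then
        if mul7 x shear' == mul7 shear' x then (x == one7) || (x == minus1) else true else true
        else true) all_mat,
      all (fun x => ~~ sign_normal (opp7 x)) psl_mats,
      all (all (fun k => k < size psl_mats)%N) psl_table
    & uniq psl_mats && (one7 \in psl_mats)].

Lemma psl_model_check : psl_model_ok.
Proof. by vm_compute. Qed.

Local Notation tmul := (tmul psl_table).

Lemma psl_table_nth i j : (i < size psl_mats)%N -> (j < size psl_mats)%N ->
  tmul i j = index (sign_norm (mul7 (nth one7 psl_mats i) (nth one7 psl_mats j))) psl_mats.
Proof. by move=> i_n j_n; rewrite /tmul /psl_table (nth_map one7) // (nth_map one7). Qed.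

Lemma size_psl_table : size psl_table = size psl_mats.
Proof. by rewrite size_map. Qed.

Lemma size_psl_row i : (i < size psl_mats)%N -> size (nth [::] psl_table i) = size psl_mats.
Proof. by move=> i_n; rewrite /psl_table (nth_map one7) // size_map. Qed.

Opaque psl_mats psl_table all_mat.

Definition psl_elt i : coset_of Z := coset Z (toGL (nth one7 psl_mats i)).

Lemma psl_matsP x : x \in psl_mats -> [/\ x \in all_mat, det7 x = 1%N & sign_normal x].
Proof. by rewrite mem_filter => /andP[/andP[/eqP dx nx] xin]. Qed.

Lemma SL_norm u : u \in SL 2 'F_7 -> u \in 'N(Z)%g.
Proof. by apply/subsetP; exact: normal_norm (center_normal (SL_group 2 'F_7)). Qed.

Lemma coset_norm x : det7 x = 1%N -> coset Z (toGL (sign_norm x)) = coset Z (toGL x).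
Proof.
move=> dx; rewrite /sign_norm; case: ifP => // _.
by rewrite toGL_opp // coset_kerl // minus1_center.
Qed.

(** SL(2,7) is generated by the two shears, so its center is already determined by
    commutation with these. *)
Lemma center_toGL x : x \in all_mat -> det7 x = 1%N -> toGL x \in Z -> x = one7 \/ x = minus1.
Proof.
move=> xin dx /centerP[_ xc].
have comm y : det7 y = 1%N -> mul7 x y = mul7 y x.
  move=> dy; apply: toM_inj; rewrite ?mul7_mat //.
  rewrite -!GLval_toGL ?det7_mul // (_ : toGL (mul7 x y) = toGL (mul7 y x)) //.
  by rewrite (toGL_mul dx dy) (toGL_mul dy dx) (xc _ (toGL_SL dy)).
have /and5P[_ /allP/(_ x xin) + _ _ _] := psl_model_check.
rewrite dx !comm // !eqxx => /orP[] /eqP; by [left|right].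
Qed.

Lemma coset_toGL_inj x y : x \in psl_mats -> y \in psl_mats ->
  coset Z (toGL x) = coset Z (toGL y) -> x = y.
Proof.
move=> xels yels E; have [xin dx nx] := psl_matsP xels; have [yin dy ny] := psl_matsP yels.
have xSL := toGL_SL dx; have ySL := toGL_SL dy.
have zZ := coset_eq (SL_norm xSL) (SL_norm ySL) E.
have [z zin [dz zE]] := SL_toGL (@divg_mem _ (SL_group 2 'F_7) _ _ xSL ySL).
have xzy := divg_eqP (esym zE).
have xE : toM x = toM z *m toM y.
  rewrite -(GLval_toGL dx) -(GLval_toGL dz) -(GLval_toGL dy) xzy.
  exact: (GL_MxE (toGL z) (toGL y)).
rewrite -zE in zZ.
have [z1|z1] := center_toGL zin dz zZ.
  by apply: (toM_inj xin yin); rewrite xE z1 toM_one mul1mx.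
have xy : x = opp7 y.
  by apply: (toM_inj xin (opp7_mat y)); rewrite toM_opp xE z1 toM_minus1 mulNmx mul1mx.
have /and5P[_ _ /allP els_opp _ _] := psl_model_check.
by move: (els_opp y yels); rewrite -xy nx.
Qed.

Lemma psl_elt_inj i j : (i < size psl_mats)%N -> (j < size psl_mats)%N -> psl_elt i = psl_elt j -> i = j.
Proof.
move=> i_n j_n /(coset_toGL_inj (mem_nth one7 i_n) (mem_nth one7 j_n)) E.
have /and5P[_ _ _ _ /andP[uels _]] := psl_model_check.
by apply/eqP; rewrite -(nth_uniq one7 i_n j_n uels) E.
Qed.

Lemma psl_tmul_lt i j : (i < size psl_mats)%N -> (j < size psl_mats)%N -> (tmul i j < size psl_mats)%N.
Proof.
move=> i_n j_n; have /and5P[_ _ _ /allP tlt _] := psl_model_check.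
have i_t : (i < size psl_table)%N by rewrite size_psl_table.
have /allP := tlt _ (mem_nth [::] i_t); apply; apply: mem_nth.
by rewrite size_psl_row.
Qed.

Lemma psl_eltM i j : (i < size psl_mats)%N -> (j < size psl_mats)%N -> psl_elt (tmul i j) = (psl_elt i * psl_elt j)%g.
Proof.
move=> i_n j_n; rewrite /psl_elt; have := psl_tmul_lt i_n j_n; rewrite psl_table_nth // index_mem => xels.
rewrite nth_index //; have [_ dx _] := psl_matsP (mem_nth one7 i_n).
have [_ dy _] := psl_matsP (mem_nth one7 j_n).
rewrite coset_norm ?det7_mul // toGL_mul //.
by rewrite (cosetM (SL_norm (toGL_SL dx)) (SL_norm (toGL_SL dy))).
Qed.

Lemma psl_elt_in i : (i < size psl_mats)%N -> psl_elt i \in PSL 2 'F_7.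
Proof.
move=> i_n; have [_ dx _] := psl_matsP (mem_nth one7 i_n).
by apply: mem_quotient; exact: toGL_SL.
Qed.

Lemma psl_elt_surj g : g \in PSL 2 'F_7 -> exists2 i, (i < size psl_mats)%N & psl_elt i = g.
Proof.
case/morphimP=> u _ uSL ->; have [x xin [dx <-]] := SL_toGL uSL.
have /and5P[/allP/(_ x xin) + _ _ _ _] := psl_model_check; rewrite dx /= => nels.
exists (index (sign_norm x) psl_mats); first by rewrite index_mem.
by rewrite /psl_elt nth_index // coset_norm.
Qed.

Lemma psl_one_lt : (index one7 psl_mats < size psl_mats)%N.
Proof. by have /and5P[_ _ _ _ /andP[_]] := psl_model_check; rewrite index_mem. Qed.

Lemma toGL_one : toGL one7 = 1%g.
Proof. by apply: GL_inj; rewrite GLval_toGL // toM_one. Qed.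

Lemma psl_elt_one : psl_elt (index one7 psl_mats) = 1%g.
Proof.
have /and5P[_ _ _ _ /andP[_ one_in]] := psl_model_check.
by rewrite /psl_elt (nth_index _ one_in) toGL_one coset_one.
Qed.

End ProjectiveSpecialLinear.

(** * Labelling the subgroup poset *)

Definition nontrivial_proper n e (b : bitseq) :=
  has (fun i => (i != e) && nth false b i) (iota 0 n) && has (fun i => ~~ nth false b i) (iota 0 n).
Definition masks n e T gens := [seq b <- listed n e T gens | nontrivial_proper n e b].
Definition comparabilities (M : seq bitseq) : seq (seq nat) :=
  let L := iota 0 (size M) in
  [seq let x := nth [::] M a in
       [seq b <- L | if b == a then false else
          let y := nth [::] M b in if submask x y then true else submask y x] | a <- L].

Section Poset.
Variables (n e : nat) (T : seq (seq nat)) (gT : finGroupType) (G : {group gT}) (elt : nat -> gT).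
Hypothesis elt_in : forall i, i < n -> elt i \in G.
Hypothesis elt_surj : forall g, g \in G -> exists2 i, i < n & elt i = g.
Hypothesis elt_inj : forall i j, i < n -> j < n -> elt i = elt j -> i = j.
Hypothesis tmul_lt : forall i j, i < n -> j < n -> tmul T i j < n.
Hypothesis eltM : forall i j, i < n -> j < n -> elt (tmul T i j) = (elt i * elt j)%g.
Hypotheses (e_lt : e < n) (elt1 : elt e = 1%g).
Variable gens : seq (seq nat).
Hypothesis gens_ok : classified n e T gens.
Let inv_ok : inverses_ok n e T. Proof. by case/andP: gens_ok. Qed.
Let M := masks n e T gens.

Lemma maskP b : b \in M -> b \in listed n e T gens /\ nontrivial_proper n e b.
Proof. by rewrite mem_filter => /andP[]. Qed.

Lemma mask_size b : b \in M -> size b = n.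
Proof. by case/maskP => bl _; exact: (listed_size tmul_lt inv_ok bl). Qed.

Lemma mask_group b : b \in M -> <<carrier n elt b>>%g = carrier n elt b.
Proof.
case/maskP => bl _.
have grp := listed_group elt_inj tmul_lt eltM e_lt elt1 inv_ok gens_ok bl.
exact: (gen_set_id grp).
Qed.

Lemma mask_proper b : b \in M -> proper_nontrivial G <<carrier n elt b>>%G.
Proof.
move=> bM; have [_ /andP[/hasP[i + /andP[ie bi]] /hasP[j + bj]]] := maskP bM.
rewrite !mem_iota => i_n j_n; rewrite /proper_nontrivial /= mask_group //.
apply/andP; split; apply/properP; split.
- by rewrite -(mask_group bM) sub1G.
- exists (elt i); first by rewrite mem_carrier.
  by rewrite inE -elt1; apply: contra ie => /eqP /elt_inj ->.
- by apply/subsetP => _ /carrierP[k [kn _ ->]]; exact: elt_in.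
- by exists (elt j); [exact: elt_in|rewrite mem_carrier].
Qed.

Section Labels.
Hypothesis uniqM : uniq M.
Variable dflt : subgroup_poset G.

Definition label (a : nat) : subgroup_poset G :=
  insubd dflt <<carrier n elt (nth [::] M a)>>%G.

Lemma val_label a : a < size M -> val (label a) = carrier n elt (nth [::] M a) :> {set gT}.
Proof.
move=> aM; have bM := mem_nth [::] aM.
by rewrite /label val_insubd mask_proper //= mask_group.
Qed.

Lemma label_le a b : a < size M -> b < size M ->
  (label a <= label b)%O = submask (nth [::] M a) (nth [::] M b).
Proof.
move=> aM bM; rewrite -(@carrier_sub n _ elt elt_inj) ?mask_size ?mem_nth //.
by rewrite -!val_label.
Qed.

Lemma label_inj a b : a < size M -> b < size M -> label a = label b -> a = b.
Proof.
move=> aM bM E; apply/eqP; rewrite -(nth_uniq [::] aM bM uniqM); apply/eqP.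
have sa := mask_size (mem_nth [::] aM); have sb := mask_size (mem_nth [::] bM).
have le_ab : submask (nth [::] M a) (nth [::] M b) by rewrite -label_le // E.
have le_ba : submask (nth [::] M b) (nth [::] M a) by rewrite -label_le // E.
apply: (@eq_from_nth _ false) => [|i _]; first by rewrite sa.
by apply/idP/idP; apply: submask_nth.
Qed.

Lemma label_surj H : exists2 a, a < size M & label a = H.
Proof.
have /andP[/properP[_ [h hH h1]] HG] := valP H.
have [|HeqG|[b bl bE]] := classification elt_in elt_surj elt_inj tmul_lt eltM e_lt elt1 inv_ok gens_ok (H := val H).
- exact: proper_sub.
- by move: HG; rewrite HeqG properxx.
have bM : b \in M.
  rewrite mem_filter bl andbT; apply/andP; split; apply/hasP.
    move: hH; rewrite bE => /carrierP[i [i_n bi hi]]; exists i; rewrite ?mem_iota // bi andbT.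
    by apply: contraNneq h1 => ie; rewrite hi ie elt1 inE.
  have [_ [g /elt_surj[i i_n <-] gH]] := properP HG.
  by exists i; rewrite ?mem_iota // -(mem_carrier elt_inj) // -bE.
exists (index b M); first by rewrite index_mem.
by apply/val_inj/group_inj; rewrite val_label ?index_mem // nth_index.
Qed.

Lemma comparabilities_nth a : a < size M -> nth [::] (comparabilities M) a =
  [seq b <- iota 0 (size M) | if b == a then false else
          if submask (nth [::] M a) (nth [::] M b) then true else submask (nth [::] M b) (nth [::] M a)].
Proof. by move=> aM; rewrite (nth_map 0) ?size_iota // nth_iota. Qed.

Lemma label_cmp a b : a < size M -> b < size M ->
  (label a >=< label b)%O = lab_cmp (comparabilities M) a b.
Proof.
move=> aM bM; rewrite /lab_cmp; have [->|ab] := eqVneq a b; first exact: comparablexx.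
rewrite /lab_adj comparabilities_nth // mem_filter mem_iota bM andbT eq_sym (negPf ab).
by rewrite -!label_le // andbT /Order.comparable; case: (label a <= label b)%O.
Qed.

End Labels.

Theorem subgroup_poset_wedge (R : realType) (I : finType) (dim : I -> nat) (crl : I -> seq nat)
    (i0 : I) (v0 : nat) (crits : seq (seq nat)) (st : seq (seq nat * nat)) :
  (forall i, size (crl i) = (dim i).+1) -> injective crl ->
  (forall c, reflect (exists i, c = crl i) (c \in crits)) ->
  uniq M -> certificate_ok (size M) (comparabilities M) v0 crits st ->
  homotopy_equivalent R (realization R (order_complex (subgroup_poset G))) (sphere_wedge R dim).
Proof.
move=> crl_size crl_inj crl_codom uniqM ok.
have v0M : v0 < size M by case/and4P: ok => _ _ _ /andP[].
pose dflt : subgroup_poset G := Sub _ (mask_proper (mem_nth [::] v0M)).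
exact: (certified_wedge (label_surj dflt) (@label_inj uniqM dflt) (label_cmp dflt)
  R i0 crl_size crl_inj crl_codom ok).
Qed.

End Poset.

(** * The critical cells and the collapse for PSL(2,7) *)

(** The labels follow the order of the generators in [psl_gens]: C2 are 0-20, C3
    are 21-48, C4 are 49-69, the Klein four-groups are 70-76 and 77-83, S3 are
    84-111, C7 are 112-119, D8 are 120-140, A4 are 141-154, the groups of order 21
    are 155-162, and S4 are 163-169 and 170-176, one class for the points and one
    for the lines of the Fano plane. *)
Definition critical_edges : seq (seq nat) := [seq [:: e.1; e.2] | e <-
  [::
    (27,155); (29,155); (33,155); (36,155); (38,155); (39,155); (25,156); (30,156); (33,156);
    (35,156); (42,156); (43,156); (31,157); (34,157); (37,157); (38,157); (43,157); (44,157);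
    (25,158); (32,158); (36,158); (41,158); (44,158); (45,158); (26,159); (29,159); (34,159);
    (40,159); (45,159); (46,159); (27,160); (30,160); (32,160); (37,160); (46,160); (47,160);
    (26,161); (28,161); (35,161); (41,161); (47,161); (48,161); (22,162); (31,162); (39,162);
    (40,162); (42,162); (48,162)]].

Definition critical_triangles : seq (seq nat) := [seq [:: e.1.1; e.1.2; e.2] | e <-
  [::
    (13,84,173); (18,84,173); (20,85,175); (16,86,172); (17,86,172); (6,87,174); (7,87,174);
    (3,88,176); (15,89,170); (10,90,176); (11,90,176); (9,91,174); (5,92,171); (6,92,171);
    (17,93,173); (18,93,173); (15,94,171); (16,94,171); (11,95,176); (14,95,176); (9,96,172);
    (10,96,172); (2,97,170); (13,98,175); (20,98,175); (9,99,172); (11,100,171); (16,100,171);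
    (15,101,170); (5,102,175); (12,102,175); (13,103,173); (18,104,174); (19,104,174);
    (12,105,170); (14,105,170); (11,106,171); (15,106,171); (4,107,172); (16,107,172);
    (3,108,173); (17,108,173); (9,109,174); (18,109,174); (13,110,175); (19,110,175);
    (10,111,176); (20,111,176)]].

Definition vertices (s : seq (nat * nat)) := [seq ([:: e.1], e.2) | e <- s].
Definition edges (s : seq (nat * nat * nat)) := [seq ([:: e.1.1; e.1.2], e.2) | e <- s].

(** The first block removes C7, the groups of order 21, A4, C4 and C3, in this
    order: each C7 lies below a single group, the group of order 21 has kept a
    single C3, the rest of the link of an A4, C4 or C3 is a cone over an S4, D8 or
    S3.  The next two blocks remove the S3 that have lost two triangles; the other
    eight S3 only lose a pendant edge of their link.  The two blocks after these
    remove the Klein four-groups.  What is left is the incidence graph of the Fano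
    plane, thickened by the involutions and with eight hexagons filled in by the
    remaining S3; it is collapsed to the vertex 125, a D8. *)
Definition collapsing : seq (seq nat * nat) := flatten [::
  vertices [::
    (112,155); (113,161); (114,162); (115,156); (116,157); (117,158); (118,159); (119,160);
    (155,24); (156,23); (157,28); (158,22); (159,23); (160,21); (161,24); (162,21); (141,168);
    (142,169); (143,163); (144,164); (145,165); (146,166); (147,167); (148,172); (149,173);
    (150,174); (151,175); (152,176); (153,170); (154,171); (49,135); (50,122); (51,124);
    (52,126); (53,134); (54,130); (55,123); (56,138); (57,131); (58,136); (59,125); (60,140);
    (61,139); (62,137); (63,129); (64,127); (65,128); (66,133); (67,120); (68,132); (69,121);
    (21,96); (22,88); (23,101); (24,109); (25,102); (26,92); (27,108); (28,85); (29,107);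
    (30,104); (31,87); (32,97); (33,111); (34,90); (35,103); (36,106); (37,94); (38,105);
    (39,110); (40,93); (41,86); (42,100); (43,99); (44,84); (45,91); (46,98); (47,95); (48,89)];
  edges [::
    (84,173,0); (20,85,169); (86,172,10); (87,174,2); (3,88,163); (15,89,165); (90,176,3);
    (9,91,169); (92,171,0); (93,173,8); (94,171,5); (95,176,7); (96,172,1); (2,97,167);
    (98,175,12); (9,99,167); (100,171,0); (15,101,164); (102,175,1); (13,103,163);
    (104,174,6); (105,170,8); (106,171,6); (107,172,1); (108,173,0); (109,174,2); (110,175,5);
    (111,176,7)];
  vertices [::
    (84,168); (86,166); (87,164); (90,166); (92,168); (93,167); (94,165); (95,164); (96,169);
    (98,163); (100,166); (102,165); (104,168); (105,163); (106,164); (107,165); (108,166);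
    (109,167); (110,168); (111,169)];
  edges [::
    (70,170,125); (70,172,129); (70,176,134); (71,170,135); (71,171,131); (71,173,127);
    (72,171,136); (72,172,123); (72,174,128); (73,172,137); (73,173,122); (73,175,133);
    (74,173,138); (74,174,126); (74,176,120); (75,170,132); (75,174,139); (75,175,124);
    (76,171,121); (76,175,140); (76,176,130); (77,163,123); (77,164,137); (77,168,129);
    (78,164,122); (78,165,138); (78,169,127); (79,163,128); (79,165,126); (79,166,139);
    (80,164,133); (80,166,124); (80,167,140); (81,165,120); (81,167,130); (81,168,134);
    (82,166,132); (82,168,125); (82,169,135); (83,163,136); (83,167,121); (83,169,131)];
  vertices [::
    (70,168); (71,169); (72,163); (73,164); (74,165); (75,166); (76,167); (77,172); (78,173);
    (79,174); (80,175); (81,176); (82,170); (83,171)];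
  edges [::
    (0,166,132); (0,168,125); (0,171,131); (0,173,127); (1,165,138); (1,172,137); (2,167,140);
    (2,174,139); (3,166,139); (3,176,120); (5,165,120); (5,168,134); (5,171,121); (5,175,140);
    (6,164,137); (6,168,129); (6,171,136); (6,174,128); (7,164,122); (7,176,120); (9,167,121);
    (9,169,131); (9,172,123); (9,174,128); (10,166,132); (10,169,135); (10,172,129);
    (10,176,134); (11,164,133); (11,166,124); (11,171,121); (11,176,130); (12,163,128);
    (12,175,124); (13,163,123); (13,168,129); (13,173,122); (13,175,133); (15,164,122);
    (15,165,138); (15,170,135); (15,171,131); (16,165,126); (16,166,139); (16,171,136);
    (16,172,123); (17,166,124); (17,173,122); (18,167,130); (18,168,134); (18,173,138);
    (18,174,126); (19,168,125); (20,169,131); (20,175,140)];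
  edges [::
    (0,125,170); (0,127,169); (0,131,169); (0,132,170); (0,169,135); (0,170,135); (1,137,164);
    (1,138,173); (2,139,166); (2,140,175); (3,120,165); (3,139,174); (5,120,176); (5,121,167);
    (5,134,176); (5,140,167); (5,167,130); (5,176,130); (6,128,163); (6,129,172); (6,136,163);
    (6,137,172); (6,163,123); (6,172,123); (7,120,165); (7,122,173); (9,121,171); (9,123,163);
    (9,128,163); (9,131,171); (9,163,136); (9,171,136); (10,129,168); (10,132,170);
    (10,134,168); (10,135,170); (10,168,125); (10,170,125); (11,121,167); (11,124,175);
    (11,130,167); (11,133,175); (11,167,140); (11,175,140); (12,124,166); (12,128,174);
    (13,122,164); (13,123,172); (13,129,172); (13,133,164); (13,164,137); (13,172,137);
    (15,122,173); (15,131,169); (15,135,169); (15,138,173); (15,169,127); (15,173,127);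
    (16,123,163); (16,126,174); (16,136,163); (16,139,174); (16,163,128); (16,174,128);
    (17,122,164); (17,124,175); (18,126,165); (18,130,176); (18,134,176); (18,138,165);
    (18,165,120); (18,176,120); (19,125,170); (20,131,171); (20,140,167)];
  vertices [::
    (0,135); (5,130); (6,123); (9,136); (10,125); (11,140); (13,137); (15,127); (16,128);
    (18,120); (120,4); (122,1); (123,14); (128,3); (131,8); (140,17)];
  edges [::
    (1,164,133); (1,173,127); (3,163,103); (3,174,126); (4,165,89); (14,163,88); (17,167,99);
    (17,175,133)];
  edges [::
    (1,127,169); (1,133,175); (1,169,85); (1,175,85); (3,103,173); (3,126,165); (3,165,138);
    (3,173,138); (4,89,170); (14,88,176); (14,176,134); (17,99,172); (17,133,164);
    (17,164,137); (17,172,137)];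
  vertices [::
    (1,85); (3,138); (17,137); (85,19); (88,20); (89,12); (99,4); (103,8); (133,2); (137,14);
    (138,7); (163,136); (164,101); (165,126); (172,129); (173,127); (175,124); (101,170);
    (124,166); (126,174); (127,169); (129,168); (136,171); (171,121); (2,132); (7,91);
    (91,19); (121,167); (169,135); (174,139); (20,130); (130,4); (135,170); (139,166);
    (166,132); (167,97); (176,4); (8,97); (12,132); (19,132); (97,4); (132,170); (134,168);
    (168,125); (170,125); (4,125); (14,125)]].

(** Generators of the trivial subgroup and of a representative of each conjugacy
    class of proper nontrivial subgroups: C2, C3, C4, two classes of Klein
    four-groups, S3, C7, D8, two classes of A4, the group of order 21, and two
    classes of S4. *)
Definition psl_gens : seq (seq nat) := [seq [seq index x psl_mats | x <- g] | g <-
 [:: [::];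
     [:: (0, 1, (6, 0))];
     [:: (0, 1, (6, 1))];
     [:: (2, 2, (5, 2))];
     [:: (0, 1, (6, 0)); (2, 3, (3, 5))];
     [:: (0, 1, (6, 0)); (2, 4, (4, 5))];
     [:: (0, 1, (6, 0)); (0, 2, (3, 0))];
     [:: (0, 1, (6, 2))];
     [:: (0, 1, (6, 0)); (1, 1, (1, 2))];
     [:: (0, 1, (6, 0)); (0, 2, (3, 1))];
     [:: (0, 1, (6, 0)); (0, 2, (3, 6))];
     [:: (0, 1, (6, 1)); (0, 2, (3, 1))];
     [:: (0, 1, (6, 0)); (1, 1, (2, 3))];
     [:: (0, 1, (6, 0)); (1, 1, (4, 5))]]].

Notation psl_order := (size psl_mats).
Notation psl_unit := (index one7 psl_mats).
Notation psl_masks := (masks psl_order psl_unit psl_table psl_gens).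

Lemma psl_gens_ok : classified psl_order psl_unit psl_table psl_gens.
Proof. vm_cast_no_check (erefl true). Qed.

Lemma psl_masks_ok : let M := psl_masks in
  uniq M && certificate_ok (size M) (comparabilities M) 125
    (critical_edges ++ critical_triangles) collapsing.
Proof. vm_cast_no_check (erefl true). Qed.

(** * The homotopy type *)

Definition critical_cell (i : 'I_48 + 'I_48) : seq nat :=
  match i with inl k => nth [::] critical_edges k | inr k => nth [::] critical_triangles k end.

Lemma critical_cells_ok : [&& size critical_edges == 48, size critical_triangles == 48,
  all (fun c => size c == 2) critical_edges, all (fun c => size c == 3) critical_triangles
  & uniq critical_edges && uniq critical_triangles].
Proof. by vm_compute. Qed.

Opaque critical_edges critical_triangles collapsing psl_gens psl_mats psl_table.

Lemma critical_cell_size i :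
  size (critical_cell i) = (match i with inl _ => 1 | inr _ => 2 end).+1.
Proof.
have /and5P[/eqP se /eqP st /allP ae /allP at_ _] := critical_cells_ok.
by case: i => k /=; apply/eqP; [apply: ae|apply: at_]; rewrite mem_nth ?se ?st.
Qed.

Lemma critical_cell_inj : injective critical_cell.
Proof.
have /and5P[/eqP se /eqP st _ _ /andP[ue ut]] := critical_cells_ok.
move=> [k|k] [l|l] E; first 1 last.
- by have := critical_cell_size (inl k); rewrite E critical_cell_size.
- by have := critical_cell_size (inr k); rewrite E critical_cell_size.
- by move/eqP: E; rewrite /= nth_uniq ?st ?ltn_ord // => /eqP/val_inj->.
- by move/eqP: E; rewrite /= nth_uniq ?se ?ltn_ord // => /eqP/val_inj->.
Qed.

Lemma critical_cellP c :
  reflect (exists i, c = critical_cell i) (c \in critical_edges ++ critical_triangles).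
Proof.
have /and5P[/eqP se /eqP st _ _ _] := critical_cells_ok.
rewrite mem_cat; apply: (iffP orP) => [[|]|[[k|k] ->]].
- move=> /(nthP [::])[k]; rewrite se => k48 <-; by exists (inl (Ordinal k48)).
- move=> /(nthP [::])[k]; rewrite st => k48 <-; by exists (inr (Ordinal k48)).
- by left; rewrite mem_nth ?se.
- by right; rewrite mem_nth ?st.
Qed.

Theorem theorem3p1 (R : realType) :
  homotopy_equivalent R
    (realization R (order_complex (subgroup_poset (PSL 2 'F_7))))
    (sphere_wedge R
       (fun i : 'I_48 + 'I_48 => match i with inl _ => 1 | inr _ => 2 end)).
Proof.
have /andP[uM ok] := psl_masks_ok.
exact: (subgroup_poset_wedge psl_elt_in psl_elt_surj psl_elt_inj psl_tmul_lt psl_eltM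
  psl_one_lt psl_elt_one psl_gens_ok R (inl ord0) critical_cell_size critical_cell_inj critical_cellP uM ok).
Qed.
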